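(* Let $G$ be a connected $n$-vertex graph that is not isomorphic to any graph in $\mathcal{E}_4 = \{C_4, C_4', K_4, G_1, G_2, G_3, G_4, G_5, G_6\}$. Then \[\iota(G, C_4) \leq \left\lfloor \frac{n}{5} \right\rfloor.\] Moreover, equality holds if $G = B_{n,C_4}$.
   Context: All graphs are finite and simple. For a graph $G$ and $D \subseteq V(G)$, $N[D]$ denotes the closed neighbourhood $\bigcup_{v\in D}(\{v\}\cup N(v))$ and $G - N[D]$ the subgraph induced by $V(G)\setminus N[D]$. A set $D \subseteq V(G)$ is a $C_4$-isolating set of $G$ if $G - N[D]$ contains no subgraph isomorphic to the $4$-cycle $C_4$; $\iota(G, C_4)$ is the minimum size of a $C_4$-isolating set of $G$. $C_4'$ is the diamond graph on $\{1,2,3,4\}$ with edges $12,23,34,41,13$. The graphs $G_1,\dots,G_6$ all have vertex set $\{1,\dots,9\}$ and edge sets: $G_1$: all pairs $\{i,j\}$ with $j-i \equiv \pm1$ or $\pm 2 \pmod 9$ (the circulant $C_9(1,2)$); $G_2$: $56,58,59,54,61,67,68,12,17,19,23,28,29,34,37,38,47,49$; $G_3$: $56,57,58,54,67,68,61,71,74,82,83,43,49,12,19,23,29,39$; $G_4$: $12,13,14,15,23,26,27,36,37,45,48,49,58,59,67,69,78,89$; $G_5$: the edges of $G_4$ except $23$; $G_6$: the edges of $G_4$ except $23$ and $45$. The graph $B_{n,C_4}$ is defined as follows: if $n \leq 4$, $B_{n,C_4}$ is the path $P_n$ on $\{1,\dots,n\}$ with edges $\{i,i+1\}$. If $n \geq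 5$, let $a = \lfloor n/5 \rfloor$ and $b = n - 4a$; take vertices $\{1,\dots,b\}$ together with $a$ pairwise vertex-disjoint copies $F_1,\dots,F_a$ of $C_4$ (disjoint from $\{1,\dots,b\}$); the edges are $\{i,i+1\}$ for $1 \le i \le a-1$, $\{a,j\}$ for $a < j \leq b$, the edges of each $F_i$, and $\{i,u\}$ for every $i \in \{1,\dots,a\}$ and every $u \in V(F_i)$. *)

(* Defs.v *)
From mathcomp Require Import all_boot.
Set Implicit Arguments. Unset Strict Implicit. Unset Printing Implicit Defensive.

(* Simple graphs: a symmetric irreflexive relation e on a finType T. *)

Definition closed_nbhd (T : finType) (e : rel T) (D : {set T}) : {set T} :=
  [set v | [exists u in D, (u == v) || e u v]].

Definition has_C4_outside (T : finType) (e : rel T) (D : {set T}) : bool :=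
  [exists a : T, exists b : T, exists c : T, exists d : T,
    [&& [&& a \notin closed_nbhd e D, b \notin closed_nbhd e D,
            c \notin closed_nbhd e D & d \notin closed_nbhd e D],
        [&& a != b, a != c, a != d, b != c, b != d & c != d] &
        [&& e a b, e b c, e c d & e d a]]].

Definition C4_isolating (T : finType) (e : rel T) (D : {set T}) : bool :=
  ~~ has_C4_outside e D.

(* iota(G, C4): minimum size of a C4-isolating set (setT is always one,
   so the bound #|T| is never the answer unless attained). *)
Definition iota_C4 (T : finType) (e : rel T) : nat :=
  \big[minn/#|T|]_(D : {set T} | C4_isolating e D) #|D|.

Definition connected_graph (T : finType) (e : rel T) : Prop :=
  forall x y : T, connect e x y.

Definition isomorphic_to (T : finType) (e : rel T) (m : nat) (e' : rel 'I_m) : Prop :=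
  exists f : T -> 'I_m, bijective f /\ forall x y, e' (f x) (f y) = e x y.

(* graph on {1,...,m} given by an edge list; vertex k is the ordinal k-1 *)
Definition edges_of (m : nat) (l : seq (nat * nat)) : rel 'I_m :=
  fun x y => ((x.+1, y.+1) \in l) || ((y.+1, x.+1) \in l).

Definition C4g : rel 'I_4 := edges_of [:: (1,2); (2,3); (3,4); (4,1)].
Definition C4'g : rel 'I_4 := edges_of [:: (1,2); (2,3); (3,4); (4,1); (1,3)].
Definition K4g : rel 'I_4 := fun x y => x != y.
Definition G1g : rel 'I_9 := fun x y => ((9 + x - y) %% 9) \in [:: 1; 2; 7; 8].
Definition G2g : rel 'I_9 := edges_of
  [:: (5,6); (5,8); (5,9); (5,4); (6,1); (6,7); (6,8); (1,2); (1,7); (1,9);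
      (2,3); (2,8); (2,9); (3,4); (3,7); (3,8); (4,7); (4,9)].
Definition G3g : rel 'I_9 := edges_of
  [:: (5,6); (5,7); (5,8); (5,4); (6,7); (6,8); (6,1); (7,1); (7,4); (8,2);
      (8,3); (4,3); (4,9); (1,2); (1,9); (2,3); (2,9); (3,9)].
Definition G4_list : seq (nat * nat) :=
  [:: (1,2); (1,3); (1,4); (1,5); (2,3); (2,6); (2,7); (3,6); (3,7); (4,5);
      (4,8); (4,9); (5,8); (5,9); (6,7); (6,9); (7,8); (8,9)].
Definition G4g : rel 'I_9 := edges_of G4_list.
Definition G5g : rel 'I_9 := edges_of (filter (fun p => p != (2,3)) G4_list).
Definition G6g : rel 'I_9 :=
  edges_of (filter (fun p => (p != (2,3)) && (p != (4,5))) G4_list).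

Definition in_E4 (T : finType) (e : rel T) : Prop :=
  isomorphic_to e C4g \/ isomorphic_to e C4'g \/ isomorphic_to e K4g \/
  isomorphic_to e G1g \/ isomorphic_to e G2g \/ isomorphic_to e G3g \/
  isomorphic_to e G4g \/ isomorphic_to e G5g \/ isomorphic_to e G6g.

(* B_{n,C4} on vertex set 'I_n.  Encoding (0-indexed): for n >= 5, with
   a = n/5, b = n - 4a, vertex u < b stands for paper vertex u+1, and vertex
   v >= b stands for vertex (v-b)%4 of the copy F_{(v-b)/4 + 1} of C4
   (cycle order 0-1-2-3-0). Bdir lists each edge in one orientation. *)
Definition Bdir (n u v : nat) : bool :=
  if n <= 4 then u.+1 == v
  else
    let a := n %/ 5 in
    let b := n - 4 * a in
    [|| (v < a) && (u.+1 == v)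
      , (u == a.-1) && (a <= v) && (v < b)
      , (b <= u) && (b <= v) && ((u - b) %/ 4 == (v - b) %/ 4)
          && (((u - b) %% 4).+1 %% 4 == (v - b) %% 4)           (* edges of F_i *)
      | (u < a) && (b <= v) && ((v - b) %/ 4 == u) ].         (* i ~ V(F_i) *)

Definition B_C4 (n : nat) : rel 'I_n := fun u v => Bdir n u v || Bdir n v u.
Arguments B_C4 : clear implicits.

(* Main.v *)
Require Import Defs.
From Stdlib Require Import BinNat.
From mathcomp Require Import all_boot zify.
Set Implicit Arguments. Unset Strict Implicit. Unset Printing Implicit Defensive.

(* Call a connected vertex set A bad if no D with 5|D| <= |A| isolates it.  A smallest bad
   graph T whose order is neither 4 nor 9 cannot exist.  Take D0 and a set Y no C4 of
   T - N[D0] meets, and isolate the components of T - Y separately: a bad component costs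
   (|C|+1)/5 vertices, or one less when D0 already touches it.  As T is bad, this gives
   |Y| + 5t < 5|D0| + m, where m counts the bad components of T - Y and t the touched ones.
   Hence (i) a bad proper subset has at least two outside neighbours; (ii) a vertex v of
   degree k has at least k - 3 bad components in T - N[v], with pairwise disjoint sets of
   outside neighbours; (iii) if H is such a component, y in H is adjacent to x in N(v), and
   what N[y] misses in H is joined to the rest by at most one edge, then the component K of v
   in T - (H + x) is bad, so v has degree at most 5.  With the structure of the six
   nine-vertex graphs this excludes degrees 5 and 4; for maximum degree 3 the same argument
   starts from N[a], where a is a vertex of a C4 with a neighbour outside it.
   The nine-vertex graphs are found by a verified search branching on the C4s that must
   avoid each closed neighbourhood. *)

(** Each bad component exceeds the budget |C|/5 by only one fifth of a vertex, while touching it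
    saves a whole vertex. So the inequality is contradictory as soon as most bad components are
    touched; when none is known to be touched, it can still be used to produce a bad component. That
    is its role in (iii): D0 consists of y and (|H| - 4)/5 further vertices which together miss at
    most one vertex of H. The set x + H has exactly 5|D0| vertices, so T - (x + H) must have a bad
    component. If this component avoided v, its only outside neighbour could be x, against (i).
    Hence v keeps all its neighbours but x in a bad set. Bad sets have maximum degree at most 4,
    because in order 9 a C4 must survive outside each closed neighbourhood; this is the origin of
    the bound 5. *)

Definition edge_list (l : seq (nat * nat)) (i j : nat) : bool :=
  ((i.+1, j.+1) \in l) || ((j.+1, i.+1) \in l).

Definition nine_adj (k : nat) : nat -> nat -> bool :=
  match k with
  | 0 => fun i j => ((9 + i - j) %% 9) \in [:: 1; 2; 7; 8]
  | 1 => edge_list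
  [:: (5,6); (5,8); (5,9); (5,4); (6,1); (6,7); (6,8); (1,2); (1,7); (1,9);
      (2,3); (2,8); (2,9); (3,4); (3,7); (3,8); (4,7); (4,9)]
  | 2 => edge_list
  [:: (5,6); (5,7); (5,8); (5,4); (6,7); (6,8); (6,1); (7,1); (7,4); (8,2);
      (8,3); (4,3); (4,9); (1,2); (1,9); (2,3); (2,9); (3,9)]
  | 3 => edge_list G4_list
  | 4 => edge_list (filter (fun p => p != (2,3)) G4_list)
  | _ => edge_list (filter (fun p => (p != (2,3)) && (p != (4,5))) G4_list)
  end.

(** * Graphs on nine vertices *)

(* The pair {i, j} with i < j is bit 'C(j, 2) + i; a state (yes, no) of the search
   records the pairs known to be edges and those known not to be edges. *)
Definition code_table : seq (seq N) := Eval vm_compute in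
  [seq [seq N.of_nat (minn i j + 'C(maxn i j, 2)) | j <- iota 0 9] | i <- iota 0 9].

(** Meaningful for distinct arguments only: (i, i) receives the code of (0, i + 1). Hence the guard
    [i != j] in [iso_leaf] and the same hypothesis in [code_relE]. *)
Definition pair_code (i j : nat) : N := nth 0%num (nth [::] code_table i) j.

Arguments pair_code : simpl never.

Definition pairs9 : seq (nat * nat) :=
  [seq p <- [seq (i, j) | i <- iota 0 9, j <- iota 0 9] | p.1 < p.2].

Definition mask (l : seq (nat * nat)) : N :=
  foldr (fun p m => N.setbit m (pair_code p.1 p.2)) 0%num l.

(** Matches and conditionals replace [&&] here and in the search because the virtual machine would
    evaluate both arguments of [&&]. *)
Definition viable (st p : N * N) : bool :=
  if N.land p.1 st.2 is 0%num then
    if N.land p.2 st.1 is 0%num then true else false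
  else false.

Definition covered (st p : N * N) : bool :=
  if N.ldiff p.1 st.1 is 0%num then
    if N.ldiff p.2 st.2 is 0%num then true else false
  else false.

Definition all_pairs_mask : N := Eval vm_compute in mask pairs9.

Fixpoint shorter (T : Type) (s t : seq T) : bool :=
  match s, t with
  | _, [::] => false
  | [::], _ => true
  | _ :: s', _ :: t' => shorter s' t'
  end.

(** A branching heuristic: take a constraint with fewest alternatives and decide a pair of its first
    alternative, required non-edges before edges. If that alternative is settled or no constraint is
    left, decide the free pair of largest code. Soundness holds for any choice. *)
Definition pick_pair (st : N * N) (cs : seq (seq (N * N))) : N :=
  let free := N.ldiff (N.ldiff all_pairs_mask st.1) st.2 in
  let c := foldr (fun c best => if shorter c best then c else best)
             (head [::] cs) cs in
  let p := head (0%num, 0%num) c in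
  if N.ldiff p.2 st.2 is N0 then
    if N.ldiff p.1 st.1 is N0 then N.log2 free
    else N.log2 (N.ldiff p.1 st.1)
  else N.log2 (N.ldiff p.2 st.2).

(** A form of unit propagation: when a single alternative is left, all its pairs become known. *)
Definition forced (c : seq (N * N)) : N * N :=
  if c is p :: c' then
    foldr (fun q m => (N.land q.1 m.1, N.land q.2 m.2)) p c' else (0%num, 0%num).

Definition rows (r : nat -> nat -> bool) : seq (seq bool) :=
  [seq [seq r i j | j <- iota 0 9] | i <- iota 0 9].

Definition nine_rows : seq (seq (seq bool)) := Eval vm_compute in
  [seq rows (nine_adj k) | k <- iota 0 6].

Definition nine_entry (k i j : nat) : bool :=
  nth false (nth [::] (nth [::] nine_rows k) i) j.

Fixpoint agree (row row' : seq bool) (f : seq nat) : bool :=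
  match f, row' with
  | d :: f', b :: row'' => if Bool.eqb (nth false row d) b then agree row row'' f' else false
  | _, _ => true
  end.

(** An untrusted backtracking search; only its answer is certified, by [iso_check]. *)
Fixpoint find_iso (R S : seq (seq bool)) (f : seq nat) : option (seq nat) :=
  if S is row' :: S' then
    (fix go (l : seq nat) := if l is c :: l' then
       if c \in f then go l' else
       if agree (nth [::] R c) row' f then
         if find_iso R S' (rcons f c) is Some r then Some r else go l'
       else go l' else None) (iota 0 9)
  else Some f.

Definition iso_check (st : N * N) (k : nat) (f : seq nat) : bool :=
  perm_eq f (iota 0 9) &&
  all (fun p => N.testbit (if nine_entry k p.1 p.2 then st.1 else st.2)
     (pair_code (nth 0 f p.1) (nth 0 f p.2))) pairs9.

(* The number of triangles tells the six graphs apart, so that only one isomorphism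
   has to be looked for. *)
Definition triangles (R : seq (seq bool)) : nat :=
  let r i j := nth false (nth [::] R i) j in
  sumn [seq count (fun k => r p.1 k && r p.2 k) (iota 0 9) |
         p <- pairs9 & r p.1 p.2].

Definition triangle_counts : seq nat := Eval vm_compute in map triangles nine_rows.

Definition iso_leaf (st : N * N) : bool :=
  let R := rows (fun i j => (i != j) && N.testbit st.1 (pair_code i j)) in
  let k := index (triangles R) triangle_counts in
  if find_iso R (nth [::] nine_rows k) [::] is Some f then
    (k < 6) && iso_check st k f else false.

Definition reach_step (n : N) (s : seq nat) : seq nat :=
  [seq j <- iota 0 9 | (j \in s) || has (fun i => ~~ N.testbit n (pair_code i j)) s].

Definition sep_check (st : N * N) (s : seq nat) : bool :=
  [&& all (ltn^~ 9) s, 0 \in s, has (fun j => j \notin s) (iota 0 9) &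
   all (fun i => all (fun j => (j \in s) || N.testbit st.2 (pair_code i j))
      (iota 0 9)) s].

(** Eight rounds reach every vertex that can be connected to 0 by pairs not known to be non-edges.
    If some vertex is missed, the graph is disconnected. [sep_check] tests the final set itself, so
    soundness rests on that test alone. *)
Definition leaf (st : N * N) : bool :=
  if sep_check st (iter 8 (reach_step st.2) [:: 0]) then true else
  if N.eqb (N.lor st.1 st.2) all_pairs_mask then iso_leaf st else false.

(** [None] reports a contradiction: some constraint has lost all its alternatives. A constraint with
    an alternative already realised by [st] is dropped. *)
Fixpoint reduce (st : N * N) (cs : seq (seq (N * N))) : option (seq (seq (N * N))) :=
  if cs is c :: cs' then
    if [seq p <- c | viable st p] is p :: c1 then
      if reduce st cs' is Some cs1 then
        if (fix go l := if l is q :: l' then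
               if covered st q then true else go l' else false) (p :: c1)
        then Some cs1 else Some ((p :: c1) :: cs1)
      else None
    else None
  else Some [::].

Definition propagate (st : N * N) (cs : seq (seq (N * N))) : N * N :=
  foldr (fun c st' => let m := forced c in (N.lor m.1 st'.1, N.lor m.2 st'.2)) st cs.

Fixpoint search (fuel : nat) (st0 : N * N) (cs : seq (seq (N * N))) : bool :=
  if fuel is n.+1 then
    if reduce st0 cs is Some cs1 then
      let st := propagate st0 cs1 in
      if (if cs1 is [::] then leaf st else false) then true else
      let x := pick_pair st cs1 in
      if search n (st.1, N.setbit st.2 x) cs1
      then search n (N.setbit st.1 x, st.2) cs1 else false
    else true
  else false.

(* Each entry is the pair (edges of a C4, pairs from u to that C4); every C4 is listed once,
   from its least vertex and towards the smaller of its neighbours there. *)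
Definition squares_avoiding (u : nat) : seq (N * N) :=
  [seq (mask [:: (q.1.1, q.1.2); (q.1.2, q.2.1); (q.2.1, q.2.2); (q.2.2, q.1.1)],
        mask [:: (u, q.1.1); (u, q.1.2); (u, q.2.1); (u, q.2.2)]) |
    q <- [seq q <- [seq (p, p') | p <- [seq (i, j) | i <- iota 0 9, j <- iota 0 9],
                     p' <- [seq (i, j) | i <- iota 0 9, j <- iota 0 9]]
         | [&& q.1.1 < q.1.2, q.1.1 < q.2.1, q.1.2 < q.2.2, q.1.1 < q.2.2,
             q.1.2 != q.2.1, q.2.1 != q.2.2 & u \notin [:: q.1.1; q.1.2; q.2.1; q.2.2]]]].

Definition root_state : N * N :=
  (mask [:: (5,6); (6,7); (7,8); (8,5)], mask [:: (0,5); (0,6); (0,7); (0,8)]).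

Definition all_squares := Eval vm_compute in [seq squares_avoiding u | u <- iota 0 9].


(** 37 is one more than the number of pairs. Running out of fuel makes [search] fail, so the depth
    of the tree calls for no separate argument. *)
Lemma search_root : search 37 root_state all_squares.
Proof. by vm_cast_no_check (erefl true). Qed.

(** * Soundness of the search *)

Definition sat (G : N -> bool) (p : N * N) : Prop :=
  forall c, (N.testbit p.1 c -> G c) /\ (N.testbit p.2 c -> ~~ G c).

Definition sat_some (G : N -> bool) (c : seq (N * N)) : Prop :=
  exists2 p, p \in c & sat G p.

Lemma land_eq0 (a b : N) :
  (forall c, N.testbit a c -> ~~ N.testbit b c) -> N.land a b = 0%num.
Proof.
move=> ab; apply: N.bits_inj => c; rewrite N.land_spec N.bits_0.
by case Ea: (N.testbit a c) => //=; apply/negbTE/ab.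
Qed.

Lemma sat_viable G st p : sat G st -> sat G p -> viable st p.
Proof.
move=> Gst Gp; rewrite /viable !land_eq0 // => c.
  by move=> /(proj2 (Gp c)) nG; apply: contra nG => /(proj1 (Gst c)).
by move=> /(proj1 (Gp c)) Gc; apply/negP => /(proj2 (Gst c)); rewrite Gc.
Qed.

Lemma reduce_sat G st cs : sat G st -> {in cs, forall c, sat_some G c} ->
  exists2 cs1, reduce st cs = Some cs1 & {in cs1, forall c, sat_some G c}.
Proof.
move=> Gst; elim: cs => [|c cs IH] Gcs; first by exists [::].
have [|cs1 /= -> Gcs1] := IH; first by move=> d dcs; apply: Gcs; rewrite inE dcs orbT.
have [p pc Gp] := Gcs c (mem_head _ _).
have : p \in [seq p <- c | viable st p] by rewrite mem_filter pc (sat_viable Gst).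
case: [seq p <- c | viable st p] => // q c1 pq.
set b := (X in if X then _ else _); case: b; first by exists cs1.
exists ((q :: c1) :: cs1) => // d; rewrite inE => /predU1P[->|/Gcs1//].
by exists p.
Qed.

Lemma forced_sat G c : sat_some G c -> sat G (forced c).
Proof.
case: c => [|p c [q + Gq]]; first by case.
have sub (m : N * N) : (forall i, (N.testbit m.1 i -> N.testbit q.1 i) /\
    (N.testbit m.2 i -> N.testbit q.2 i)) -> sat G m.
  by move=> mq i; have [G1 G2] := Gq i; have [m1 m2] := mq i; split=> [/m1|/m2].
rewrite inE => qpc; apply: sub => i /=.
elim: c qpc => [|q' c IH].
  by rewrite orbF => /eqP <-.
rewrite inE /= => /or3P[/eqP qp|/eqP <-|qc].
- have [|IH1 IH2] := IH; first by rewrite qp eqxx.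
  by rewrite !N.land_spec; split=> /andP[_] // /IH1 // /IH2.
- by rewrite !N.land_spec; split=> /andP[].
have [|IH1 IH2] := IH; first by rewrite qc orbT.
by rewrite !N.land_spec; split=> /andP[_]; [apply: IH1 | apply: IH2].
Qed.

Lemma propagate_sat G st cs :
  sat G st -> {in cs, forall c, sat_some G c} -> sat G (propagate st cs).
Proof.
move=> Gst; elim: cs => [|c cs IH] Gcs //= i.
have Gc := forced_sat (Gcs c (mem_head _ _)).
have {}IH := IH (fun d dcs => Gcs d (mem_behead (s := c :: cs) dcs)).
have [G1 G2] := Gc i; have [I1 I2] := IH i.
by rewrite !N.lor_spec; split=> /orP[]; [apply: G1|apply: I1|apply: G2|apply: I2].
Qed.

Lemma setbit_sat G st x : sat G st ->
  sat G (if G x then (N.setbit st.1 x, st.2) else (st.1, N.setbit st.2 x)).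
Proof.
move=> Gst c; have [G1 G2] := Gst c.
by case Gx: (G x); split=> //=; rewrite N.setbit_eqb => /orP[/N.eqb_eq <-|]; rewrite ?Gx.
Qed.

(** The graph [G] itself selects the branch: following the value [G x] at each decision preserves
    the state and all constraints, until a leaf accepts. *)
Lemma search_sound G n st cs : search n st cs -> sat G st ->
  {in cs, forall c, sat_some G c} -> exists2 st', sat G st' & leaf st'.
Proof.
elim: n st cs => //= n IH st cs + Gst Gcs.
have [cs1 -> Gcs1] := reduce_sat Gst Gcs.
have := propagate_sat Gst Gcs1; set st1 := propagate st cs1 => Gst1.
case E: (match cs1 with [::] => _ | _ => _ end).
  by move=> _; exists st1 => //; case: (cs1) E.
set x := pick_pair st1 cs1; have := setbit_sat x Gst1.
case: (G x) => G2.
  by case: (search n (_, N.setbit _ _) _) => // /IH; apply.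
by case E2: (search n (_, N.setbit _ _) _) => // _; apply: IH E2 _ _.
Qed.

Definition code_rel (r : rel nat) (c : N) : bool :=
  has (fun p => N.eqb (pair_code p.1 p.2) c && r p.1 p.2) pairs9.

Lemma all_iota9P (P : pred nat) : all P (iota 0 9) -> forall i, i < 9 -> P i.
Proof. by move/allP=> allP i lti; apply: allP; rewrite mem_iota. Qed.

Lemma pair_codeC i j : i < 9 -> j < 9 -> pair_code i j = pair_code j i.
Proof.
move=> lti ltj; apply/N.eqb_eq; move: j ltj; apply: all_iota9P; move: i lti.
by apply: (@all_iota9P (fun i => all (fun j => N.eqb (pair_code i j) (pair_code j i)) (iota 0 9))).
Qed.

Lemma mem_pairs9 i j : ((i, j) \in pairs9) = (i < j < 9).
Proof.
rewrite mem_filter -[(i, j).1 < _]/(i < j); have [ltij|//] := ltnP i j; rewrite !andTb.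
apply/allpairsP/idP => [[[a b] [_ + [_ ->]]]|ltj]; first by rewrite mem_iota.
by exists (i, j); rewrite !mem_iota ltj (ltn_trans ltij).
Qed.

Lemma code_relE r i j : symmetric r -> i < 9 -> j < 9 -> i != j ->
  code_rel r (pair_code i j) = r i j.
Proof.
move=> rsym; wlog ltij: i j / i < j.
  move=> W lti ltj ij; move: (ij); rewrite neq_ltn => /orP[lt|lt]; first exact: W.
  by rewrite pair_codeC // rsym; apply: W; rewrite // eq_sym.
move=> lti ltj _; apply/hasP/idP => [[[a b] pab /= /andP[/N.eqb_eq E]]|rij]; last first.
  by exists (i, j); rewrite ?mem_pairs9 ?ltij //= rij N.eqb_refl.
suff /eqP[-> ->] : (a, b) == (i, j) by [].
have inj : all (fun p => all (fun q => N.eqb (pair_code p.1 p.2) (pair_code q.1 q.2)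
    ==> (p == q)) pairs9) pairs9 by vm_compute.
have /allP/(_ _ pab)/allP/(_ (i, j)) := inj.
by rewrite mem_pairs9 ltij ltj E N.eqb_refl => /(_ isT).
Qed.

Lemma mask_testbit l c : N.testbit (mask l) c ->
  exists2 p, p \in l & pair_code p.1 p.2 = c.
Proof.
elim: l => [|p l IH] //=; rewrite N.setbit_eqb => /orP[/N.eqb_eq <-|/IH[q ql <-]].
  by exists p; rewrite ?mem_head.
by exists q; rewrite // inE ql orbT.
Qed.

Lemma mask_sat r l l' : symmetric r ->
  {in l, forall p, [&& p.1 < 9, p.2 < 9, p.1 != p.2 & r p.1 p.2]} ->
  {in l', forall p, [&& p.1 < 9, p.2 < 9, p.1 != p.2 & ~~ r p.1 p.2]} ->
  sat (code_rel r) (mask l, mask l').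
Proof.
move=> rsym Hl Hl' c; split=> /mask_testbit[p pl <-].
  by have /and4P[? ? ? ?] := Hl p pl; rewrite code_relE.
by have /and4P[? ? ? ?] := Hl' p pl; rewrite code_relE.
Qed.

Definition square_at (r : rel nat) (u : nat) (a b c d : nat) : bool :=
  [&& [&& a < 9, b < 9, c < 9 & d < 9], uniq [:: u; a; b; c; d],
      [&& r a b, r b c, r c d & r d a] &
      [&& ~~ r u a, ~~ r u b, ~~ r u c & ~~ r u d]].

Lemma square_at_flip r u a b c d : symmetric r ->
  square_at r u a b c d -> square_at r u a d c b.
Proof.
move=> rsym /and4P[/and4P[? ? ? ?] uq /and4P[? ? ? ?] /and4P[? ? ? ?]].
apply/and4P; split; try by apply/and4P; split; rewrite // rsym.
rewrite -[[:: a; d; c; b]]/(rot 3 (rev [:: a; b; c; d])).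
by rewrite cons_uniq mem_rot mem_rev rot_uniq rev_uniq.
Qed.

Lemma square_at_rot r u a b c d : symmetric r ->
  square_at r u a b c d -> square_at r u b c d a.
Proof.
move=> rsym /and4P[/and4P[? ? ? ?] uq /and4P[? ? ? ?] /and4P[? ? ? ?]].
apply/and4P; split; try by apply/and4P.
by rewrite -[[:: b; c; d; a]]/(rot 1 [:: a; b; c; d]) cons_uniq mem_rot rot_uniq.
Qed.

(** The enumeration keeps one of the eight descriptions of a C4: rotations bring the least vertex to
    the front, and a reflection then orders its two neighbours. *)
Lemma sat_squares r u a b c d : symmetric r -> u < 9 -> square_at r u a b c d ->
  sat_some (code_rel r) (squares_avoiding u).
Proof.
move=> rsym ltu.
wlog lt3: a b c d / [&& a < b, a < c & a < d].
  move=> W sq.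
  have min4 x y z t : uniq [:: x; y; z; t] -> [|| [&& x < y, x < z & x < t],
     [&& y < z, y < t & y < x], [&& z < t, z < x & z < y] | [&& t < x, t < y & t < z]].
    by rewrite /= !inE; lia.
  have sq1 := square_at_rot rsym sq; have sq2 := square_at_rot rsym sq1.
  have sq3 := square_at_rot rsym sq2.
  have /and4P[_ /=/andP[_ uq] _ _] := sq.
  by case/or4P: (min4 _ _ _ _ uq) => lt; [move: sq|move: sq1|move: sq2|move: sq3]; apply: W.
wlog ltbd: b d lt3 / b < d.
  move=> W sq; have [ltbd|] := ltnP b d; first exact: W sq.
  rewrite leq_eqVlt => /predU1P[E|ltdb].
    by case/and4P: sq => _; rewrite E /= !inE eqxx ?orbT ?andbF.
  by apply: W (square_at_flip rsym sq) => //; case/and3P: lt3 => -> -> ->.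
move=> sq; have /and3P[ltab ltac ltad] := lt3.
have /and4P[/and4P[a9 b9 c9 d9] uq /and4P[rab rbc rcd rda] /and4P[ua ub uc ud]] := sq.
move: uq; rewrite /= !inE !negb_or -!andbA.
case/and5P=> nua nub nuc nud /and5P[nab nac nad nbc /and3P[nbd ncd _]].
exists (mask [:: (a, b); (b, c); (c, d); (d, a)], mask [:: (u, a); (u, b); (u, c); (u, d)]).
  apply/mapP; exists ((a, b), (c, d)) => //; rewrite mem_filter; apply/andP; split.
    by rewrite /= ltab ltac ltbd ltad nbc ncd !inE !negb_or nua nub nuc nud.
  by do !apply: allpairs_f; rewrite mem_iota.
apply: mask_sat => // p; rewrite !inE => /or4P[] /eqP -> /=.
all: by rewrite ?a9 ?b9 ?c9 ?d9 ?ltu ?nab ?nbc ?ncd ?[d == a]eq_sym ?nad ?nua ?nub ?nuc ?nud.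
Qed.

Lemma nine_entryE k i j : k < 6 -> i < 9 -> j < 9 -> nine_entry k i j = nine_adj k i j.
Proof.
have rowP : all (fun k => all (fun i => all (fun j =>
    nine_entry k i j == nine_adj k i j) (iota 0 9)) (iota 0 9)) (iota 0 6).
  by vm_compute.
move=> ltk; have /allP/(_ k) := rowP; rewrite mem_iota ltk => /(_ isT)/all_iota9P rowk.
by move=> lti ltj; have /all_iota9P/(_ j ltj)/eqP := rowk i lti.
Qed.

Lemma nine_entry_simple k i j : k < 6 -> i < 9 -> j < 9 ->
  ~~ nine_entry k i i /\ nine_entry k i j = nine_entry k j i.
Proof.
have adjP : all (fun k => all (fun i => ~~ nine_entry k i i &&
    all (fun j => nine_entry k i j == nine_entry k j i) (iota 0 9)) (iota 0 9)) (iota 0 6).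
  by vm_compute.
move=> ltk lti ltj; have /allP/(_ k) := adjP; rewrite mem_iota ltk => /(_ isT)/all_iota9P adjk.
by have /andP[irr /all_iota9P/(_ j ltj) /eqP sym] := adjk i lti.
Qed.

Lemma iso_leafP st : iso_leaf st -> exists k f, k < 6 /\ iso_check st k f.
Proof.
rewrite /iso_leaf; move: (index _ _) => k; case: (find_iso _ _ _) => [f|]; last by [].
by case/andP=> ltk chk; exists k, f.
Qed.

Section SearchSound.
Variable r : rel nat.
Hypotheses (r_sym : symmetric r) (r_irr : irreflexive r).

Lemma sat_yes st i j : sat (code_rel r) st -> i < 9 -> j < 9 -> i != j ->
  N.testbit st.1 (pair_code i j) -> r i j.
Proof. by move=> Gst lti ltj ij /(proj1 (Gst _)); rewrite code_relE. Qed.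

Lemma sat_no st i j : sat (code_rel r) st -> i < 9 -> j < 9 -> i != j ->
  N.testbit st.2 (pair_code i j) -> ~~ r i j.
Proof. by move=> Gst lti ltj ij /(proj2 (Gst _)); rewrite code_relE. Qed.

Lemma iso_check_sound st k f : sat (code_rel r) st -> k < 6 -> iso_check st k f ->
  perm_eq f (iota 0 9) /\
  forall i j, i < 9 -> j < 9 -> r (nth 0 f i) (nth 0 f j) = nine_entry k i j.
Proof.
move=> Gst ltk /andP[pf /allP chk]; split; first exact: pf.
have sf : size f = 9 by rewrite (perm_size pf).
have uf : uniq f by rewrite (perm_uniq pf) iota_uniq.
have f9 i : i < 9 -> nth 0 f i < 9.
  by move=> lti; have := mem_nth 0 (_ : i < size f); rewrite sf (perm_mem pf) mem_iota => /(_ lti).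
have lt_case i j : i < j -> j < 9 -> r (nth 0 f i) (nth 0 f j) = nine_entry k i j.
  move=> ltij ltj; have lti := ltn_trans ltij ltj.
  have nij : nth 0 f i != nth 0 f j.
    by rewrite (nth_uniq 0 _ _ uf) ?sf ?lti ?ltj // neq_ltn ltij.
  have := chk (i, j); rewrite mem_pairs9 ltij ltj => /(_ isT).
  rewrite -[(i, j).1]/i -[(i, j).2]/j.
  case: (nine_entry k i j) => h; first exact: (sat_yes Gst (f9 i lti) (f9 j ltj) nij h).
  exact/negbTE/(sat_no Gst (f9 i lti) (f9 j ltj) nij h).
move=> i j lti ltj; have [irr sym] := nine_entry_simple ltk lti ltj.
case: (ltngtP i j) => [ltij|ltji|E]; first exact: lt_case.
  by rewrite r_sym sym lt_case.
by rewrite -E r_irr (negbTE irr).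
Qed.

Lemma sep_check_sound st s : sat (code_rel r) st -> sep_check st s ->
  [/\ 0 \in s, exists2 j, j < 9 & j \notin s &
      forall i j, i \in s -> j < 9 -> j \notin s -> ~~ r i j].
Proof.
move=> Gst /and4P[/allP s9 s0 /hasP[j0]].
rewrite mem_iota => /andP[_ ltj0] nj0 /allP sep; split=> [//||i j si ltj nj]; first by exists j0.
have /allP/(_ j) := sep i si; rewrite mem_iota ltj (negbTE nj) => /(_ isT).
by apply: (sat_no Gst (s9 i si) ltj); apply: contraNneq nj => <-.
Qed.

(* The first two hypotheses only fix the labelling: 5, 6, 7, 8 is a C4 avoiding N[0]. *)
Lemma nine_classification :
  [&& r 5 6, r 6 7, r 7 8 & r 8 5] ->
  [&& ~~ r 0 5, ~~ r 0 6, ~~ r 0 7 & ~~ r 0 8] ->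
  (forall u, u < 9 -> exists a b c d, square_at r u a b c d) ->
  (forall s : seq nat, 0 \in s -> (exists2 j, j < 9 & j \notin s) ->
    exists i j, [&& i \in s, j < 9, j \notin s & r i j]) ->
  exists k f, [/\ k < 6, perm_eq f (iota 0 9) &
    forall i j, i < 9 -> j < 9 -> r (nth 0 f i) (nth 0 f j) = nine_entry k i j].
Proof.
move=> /and4P[r56 r67 r78 r85] /and4P[n05 n06 n07 n08] sqs conn.
have root_sat : sat (code_rel r) root_state.
  by rewrite /root_state; apply: (mask_sat r_sym) => p; rewrite !inE => /or4P[] /eqP ->; apply/and4P.
have sqs_sat : {in all_squares, forall c, sat_some (code_rel r) c}.
  have -> : all_squares = [seq squares_avoiding u | u <- iota 0 9] by vm_compute.
  move=> _ /mapP[u + ->]; rewrite mem_iota => /andP[_ ltu].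
  have [a [b [c [d sq]]]] := sqs u ltu.
  exact: sat_squares sq.
have [st Gst] := search_sound search_root root_sat sqs_sat.
rewrite /leaf; case: ifP => [sep _|_].
  have [s0 sj sep'] := sep_check_sound Gst sep.
  have [i [j /and4P[si ltj nj rij]]] := conn _ s0 sj.
  by have := sep' i j si ltj nj; rewrite rij.
case: ifP => [_|]; last by [].
case/iso_leafP=> k [f [ltk chk]]; have [pf fk] := iso_check_sound Gst ltk chk.
by exists k, f; split; [exact: ltk | exact: pf | exact: fk].
Qed.

End SearchSound.

(** * Connected sets, components and isolating sets *)

Section Graph.
Variables (T : finType) (e : rel T).
Hypotheses (e_sym : symmetric e) (e_irr : irreflexive e).
Implicit Types (A B C D S Z H K J W Y : {set T}) (u v w x y z : T).

Notation nbh := (closed_nbhd e).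

Definition nb v : {set T} := [set u | e v u].

Definition is_C4 a b c d : bool :=
  [&& a != b, a != c, a != d, b != c, b != d & c != d] &&
  [&& e a b, e b c, e c d & e d a].

Definition C4_in A : bool :=
  [exists a, exists b, exists c, exists d,
    [&& a \in A, b \in A, c \in A & d \in A] && is_C4 a b c d].

(** [D] may contain vertices outside [A]. This suits unions of isolating sets of several parts, and
    makes badness of [A] the stronger condition that passes to the induced subgraph. *)
Definition isol A D : bool := ~~ C4_in (A :\: nbh D).

Definition conn A : bool :=
  [forall S : {set T}, [&& S \subset A, S != set0 & S != A] ==>
    [exists x in S, exists y in A :\: S, e x y]].

(* Failure of the bound itself; which sets are bad is the outcome of the proof. *)
Definition bad A : bool :=
  conn A && ~~ [exists D : {set T}, isol A D && (5 * #|D| <= #|A|)].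

Definition is_comp A C : bool :=
  [&& C \subset A, C != set0, conn C &
    [forall x in C, forall y in A :\: C, ~~ e x y]].

Definition ncomp (P : pred {set T}) A : nat :=
  #|[set C | is_comp A C && P C]|.

Definition bdry A : {set T} := [set x | (x \notin A) && [exists y in A, e y x]].

Definition touched D : pred {set T} :=
  fun C => bad C && ~~ [disjoint C & nbh D].

Lemma nbhP D v : reflect (exists2 u, u \in D & (u == v) || e u v) (v \in nbh D).
Proof.
rewrite inE; apply: (iffP existsP) => [[u /andP[]]|[u uD uv]]; first by exists u.
by exists u; rewrite uD.
Qed.

Lemma nbh1 u v : (v \in nbh [set u]) = (v == u) || e u v.
Proof.
apply/nbhP/idP => [[w /set1P->]|uv]; first by rewrite eq_sym.
by exists u; rewrite ?set11 // eq_sym.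
Qed.

Lemma nbhU D D' : nbh (D :|: D') = nbh D :|: nbh D'.
Proof.
apply/setP=> v; rewrite [RHS]inE; apply/nbhP/orP => [[u]|].
  by rewrite inE => /orP[] uD uv; [left|right]; apply/nbhP; exists u.
by case=> /nbhP[u uD uv]; exists u; rewrite // inE uD ?orbT.
Qed.

Lemma sub_nbh D : D \subset nbh D.
Proof. by apply/subsetP => x xD; apply/nbhP; exists x; rewrite ?eqxx. Qed.

Lemma nbh_edge D u v : u \in D -> e u v -> v \in nbh D.
Proof. by move=> uD uv; apply/nbhP; exists u; rewrite ?uv ?orbT. Qed.

Lemma in_nb u v : (v \in nb u) = e u v. Proof. by rewrite inE. Qed.

Lemma nbh1E u : nbh [set u] = u |: nb u.
Proof. by apply/setP => v; rewrite nbh1 !inE. Qed.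

Lemma card_nbh1 u : #|nbh [set u]| = #|nb u|.+1.
Proof. by rewrite nbh1E cardsU1 in_nb e_irr. Qed.

Lemma C4_rot a b c d : is_C4 a b c d = is_C4 b c d a.
Proof.
rewrite /is_C4 ![_ == a]eq_sym.
apply/idP/idP => /andP[/and5P[? ? ? ? /andP[? ?]] /and4P[? ? ? ?]].
  by do ![apply/andP; split=> //].
by do ![apply/andP; split=> //].
Qed.

Lemma C4P A : reflect (exists a b c d,
  [/\ a \in A, b \in A, c \in A, d \in A & is_C4 a b c d]) (C4_in A).
Proof.
apply: (iffP existsP) => [[a /existsP[b /existsP[c /existsP[d]]]]|].
  by case/andP=> /and4P[? ? ? ?] ?; exists a, b, c, d.
move=> [a [b [c [d [aA bA cA dA sq]]]]].
by exists a; apply/existsP; exists b; apply/existsP; exists c; apply/existsP; exists d; apply/andP; split=> //; apply/and4P.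
Qed.

Lemma C4_mono A B : A \subset B -> C4_in A -> C4_in B.
Proof.
move/subsetP=> AB /C4P[a [b [c [d [? ? ? ? ?]]]]].
by apply/C4P; exists a, b, c, d; split; rewrite // AB.
Qed.

Lemma isol_mono A B D D' : A \subset B -> D \subset D' -> isol B D -> isol A D'.
Proof.
move=> AB DD'; apply: contra; apply: C4_mono; apply: setDSS => //.
by rewrite -(setUidPr DD') nbhU subsetUl.
Qed.

Lemma isolN A D : ~~ isol A D -> exists a b c d,
  [/\ is_C4 a b c d, [/\ a \in A, b \in A, c \in A & d \in A] &
  [/\ a \notin nbh D, b \notin nbh D, c \notin nbh D & d \notin nbh D]].
Proof.
rewrite negbK => /C4P[a [b [c [d []]]]]; rewrite !in_setD.
case/andP=> ? ? /andP[? ?] /andP[? ?] /andP[? ?] ?.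
by exists a, b, c, d; split.
Qed.

Lemma isol_intro A D :
  (forall a b c d, is_C4 a b c d -> a \in A -> b \in A -> c \in A -> d \in A ->
     a \notin nbh D -> b \notin nbh D -> c \notin nbh D -> d \notin nbh D -> False) ->
  isol A D.
Proof.
move=> F; have [//|] := boolP (isol A D).
case/isolN=> a [b [c [d [sq [? ? ? ?] [? ? ? ?]]]]].
by case: (F a b c d).
Qed.

Lemma connP A x : x \in A -> reflect
  (forall S, x \in S -> (forall u v, u \in A -> v \in A -> u \in S -> e u v -> v \in S) ->
     A \subset S) (conn A).
Proof.
move=> xA; apply: (iffP forallP) => [cA S xS clS|cA S].
  have := cA (S :&: A); rewrite subsetIr /=; case: eqP => [E|_].
    by have := in_set0 x; rewrite -E inE xS xA.
  case: eqP => [<- _|_ /existsP[u /andP[]]]; first exact: subsetIl.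
  rewrite inE => /andP[uS uA] /existsP[v /andP[]]; rewrite !inE => /andP[+ vA] uv.
  by rewrite vA (clS u v).
apply/implyP=> /and3P[SA S0 neqSA]; apply: contraT => noe.
have sep u v : u \in S -> v \in A -> v \notin S -> ~~ e u v.
  move=> uS vA vS; apply: contra noe => uv.
  by apply/existsP; exists u; rewrite uS; apply/existsP; exists v; rewrite inE vS vA.
have [xS|xS] := boolP (x \in S).
  case/negP: neqSA; rewrite eqEsubset SA; apply: cA => // u v uA vA uS uv.
  by apply: contraTT uv => vS; apply: sep.
have/subsetP AS : A \subset A :\: S.
  apply: cA => [|u v uA vA]; rewrite !inE ?xS // => /andP[uS _] uv.
  by rewrite vA andbT; apply: contraTN uv => vS; rewrite e_sym; apply: sep.
case/set0Pn: S0 => s sS; have := AS s (subsetP SA s sS).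
by rewrite inE sS.
Qed.

Lemma conn1 x : conn [set x].
Proof. by apply/(connP (set11 x)) => S xS _; rewrite sub1set. Qed.

Lemma connU A B x : x \in A -> x \in B -> conn A -> conn B -> conn (A :|: B).
Proof.
move=> xA xB cA cB; have xAB : x \in A :|: B by rewrite inE xA.
apply/(connP xAB) => S xS cl; rewrite subUset.
apply/andP; split; [apply: (connP xA cA)|apply: (connP xB cB)] => // u v uA vA.
  by apply: cl; rewrite inE ?uA ?vA.
by apply: cl; rewrite inE ?uA ?vA orbT.
Qed.

Lemma conn_edge A B x y : x \in A -> y \in B -> e x y ->
  conn A -> conn B -> conn (A :|: B).
Proof.
move=> xA yB xy cA cB; have c2 : conn [set x; y].
  apply/(connP (set21 x y)) => S xS cl; rewrite subUset !sub1set xS /=.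
  by apply: (cl x y); rewrite ?inE ?eqxx ?orbT.
have -> : A :|: B = A :|: [set x; y] :|: B.
  apply/setP=> z; rewrite !inE; case: eqP => [->|_]; first by rewrite xA.
  by case: eqP => [->|_]; rewrite ?yB ?orbT ?orbF.
apply: (connU (x := y)) => //; first by rewrite !inE eqxx !orbT.
by apply: (connU (x := x)) => //; rewrite !inE eqxx.
Qed.

Lemma is_compP A C : reflect
  [/\ C \subset A, C != set0, conn C &
      forall x y, x \in C -> y \in A -> e x y -> y \in C] (is_comp A C).
Proof.
apply: (iffP and4P) => -[CA C0 cC H]; split=> //.
  move=> x y xC yA; apply: contraTT => yC.
  have /forall_inP/(_ x xC)/forall_inP := H; apply.
  by rewrite inE yC.
apply/forall_inP => x xC; apply/forall_inP => y; rewrite inE => /andP[yC yA].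
by apply: contra yC; apply: H.
Qed.

Lemma comp_max A C B x : is_comp A C -> conn B -> B \subset A ->
  x \in B -> x \in C -> B \subset C.
Proof.
move=> /is_compP[CA _ _ cl] cB BA xB xC; apply: (connP xB cB) => // u v uB vB uC uv.
exact: cl uC (subsetP BA v vB) uv.
Qed.

Lemma comp_eq A C C' x : is_comp A C -> is_comp A C' -> x \in C -> x \in C' -> C = C'.
Proof.
move=> cC cC' xC xC'; apply/eqP; rewrite eqEsubset.
have /is_compP[CA _ kC _] := cC; have /is_compP[CA' _ kC' _] := cC'.
by rewrite (comp_max cC' kC CA xC xC') (comp_max cC kC' CA' xC' xC).
Qed.

Lemma comp_exists A x : x \in A -> exists2 C, is_comp A C & x \in C.
Proof.
move=> xA; pose P C := [&& C \subset A, x \in C & conn C].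
have P1 : P [set x] by rewrite /P sub1set xA set11 conn1.
have [C /and3P[CA xC cC] maxC] := @arg_maxnP _ [set x] P (fun C => #|C|) P1.
exists C => //; apply/is_compP; split=> // [|u v uC vA uv].
  by apply/set0Pn; exists x.
apply/negPn/negP => vC; have := maxC (C :|: [set v]).
rewrite /P subUset CA sub1set vA inE xC (conn_edge uC (set11 v) uv) ?conn1 // => /(_ isT).
by rewrite setUC cardsU1 vC /= add1n ltnn.
Qed.

(** Removing a whole component leaves the other components as they are, which allows treating
    components one at a time. *)
Lemma is_compD A C B : is_comp A C ->
  is_comp A B = (B == C) || is_comp (A :\: C) B.
Proof.
move=> cC; have /is_compP[CA C0 kC clC] := cC.
apply/idP/orP => [cB|[/eqP->//|/is_compP[BAC B0 kB clB]]].
  have [->|neq] := eqVneq B C; [by left|right].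
  have /is_compP[BA B0 kB clB] := cB.
  apply/is_compP; split=> // [|x y xB]; last by rewrite inE => /andP[_]; apply: clB.
  apply/subsetP => x xB; rewrite inE (subsetP BA) // andbT.
  by apply: contraNN neq => xC; rewrite (comp_eq cB cC xB xC).
apply/is_compP; split=> // [|x y xB yA xy]; first by apply: subset_trans BAC (subsetDl _ _).
apply: (clB x y) => //; rewrite inE yA andbT; apply/negP => yC.
have := subsetP BAC x xB; rewrite inE => /andP[/negP xC xA].
by apply: xC; apply: (clC y x); rewrite // e_sym.
Qed.

Lemma ncompD (P : pred {set T}) A C : is_comp A C -> ncomp P A = P C + ncomp P (A :\: C).
Proof.
move=> cC; rewrite /ncomp.
have nC : C \notin [set B | is_comp (A :\: C) B && P B].
  rewrite inE negb_and; apply/orP; left; apply/negP => /is_compP[/subsetP CA /set0Pn[x xC] _ _].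
  by have := CA x xC; rewrite inE xC.
have -> : [set B | is_comp A B && P B] =
    (if P C then C |: [set B | is_comp (A :\: C) B && P B]
     else [set B | is_comp (A :\: C) B && P B]).
  apply/setP => B; rewrite inE (is_compD _ cC); have [->|nBC] := eqVneq B C.
    case: (P C); rewrite ?inE ?eqxx // andbF.
    by move: nC; rewrite inE => /negbTE->.
  by case: (P C); rewrite !inE ?(negbTE nBC).
by case: (P C) => //; rewrite cardsU1 nC.
Qed.

Lemma ncomp_eq (P Q : pred {set T}) A : (forall C, is_comp A C -> P C = Q C) -> ncomp P A = ncomp Q A.
Proof.
by move=> PQ; apply: eq_card => C; rewrite !inE; case: (boolP (is_comp A C)) => [/PQ->|].
Qed.

Lemma ncomp_gt0 (P : pred {set T}) A : 0 < ncomp P A -> exists C, is_comp A C /\ P C.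
Proof. by case/card_gt0P => C; rewrite inE => /andP[]; exists C. Qed.

Lemma ncomp_eq0 (P : pred {set T}) A : (forall C, is_comp A C -> ~~ P C) -> ncomp P A = 0.
Proof.
move=> nP; apply: eq_card0 => C; rewrite !inE; apply/negP => /andP[cC].
by apply/negP/nP.
Qed.

(** A C4 is connected, so without edges between the two sets it lies in one of them. *)
Lemma isolU A B D D' : (forall x y, x \in A -> y \in B -> ~~ e x y) ->
  isol A D -> isol B D' -> isol (A :|: B) (D :|: D').
Proof.
move=> noe iA iB.
have cross x y : x \in A :|: B -> y \in A :|: B -> e x y -> (x \in A) -> (y \in A).
  rewrite !inE => _ /orP[//|yB] xy xA; by rewrite (negbTE (noe x y xA yB)) in xy.
have crossB x y : x \in A :|: B -> y \in A :|: B -> e x y -> (x \in B) -> (y \in B).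
  rewrite !inE => _ /orP[yA|//] xy xB; by rewrite e_sym (negbTE (noe y x yA xB)) in xy.
apply: isol_intro => a b c d sq aU bU cU dU; rewrite nbhU !inE !negb_or.
move=> /andP[aD aD'] /andP[bD bD'] /andP[cD cD'] /andP[dD dD'].
have /andP[_ /and4P[ab bc cd da]] := sq.
have /orP[aA|aB] : (a \in A) || (a \in B) by rewrite -in_setU.
  have bA := cross _ _ aU bU ab aA; have cA := cross _ _ bU cU bc bA.
  have dA := cross _ _ cU dU cd cA.
  by case/negP: iA; apply/C4P; exists a, b, c, d; rewrite !in_setD; split; rewrite ?inE //; apply/andP; split=> //; rewrite inE.
have bB := crossB _ _ aU bU ab aB; have cB := crossB _ _ bU cU bc bB.
have dB := crossB _ _ cU dU cd cB.
by case/negP: iB; apply/C4P; exists a, b, c, d; rewrite !in_setD; split; rewrite ?inE //; apply/andP; split=> //; rewrite inE.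
Qed.

Lemma nbad_isol A : conn A -> ~~ bad A -> exists2 D, isol A D & 5 * #|D| <= #|A|.
Proof. by rewrite /bad => -> /= /negPn/existsP[D /andP[? ?]]; exists D. Qed.

Lemma badP A : bad A -> conn A /\ forall D, isol A D -> #|A| < 5 * #|D|.
Proof.
case/andP=> cA /existsPn noD; split=> // D iD; have := noD D.
by rewrite iD -ltnNge.
Qed.

End Graph.

(** * Bad sets of four or nine vertices *)

Section NineFacts.
Variable r : nat -> nat -> bool.
Notation V9 := (iota 0 9).

Definition dom9 i j : bool := (i == j) || r i j.
Definition deg9 i : nat := count (r i) V9.

(** Only opposite vertices are compared; consecutive ones differ because the graphs have no
    loops. *)
Definition square_free9 (P : pred nat) : bool :=
  all (fun a => all (fun b => all (fun c => nilp
    [seq d <- V9 | [&& P d, r c d, r d a & d != b]])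
    [seq c <- V9 | [&& P c, r b c & c != a]])
    [seq b <- V9 | P b && r a b]) [seq a <- V9 | P a].

Definition at_most_one9 (P : pred nat) : bool :=
  all (fun z => all (pred1 z) [seq z <- V9 | P z]) [seq z <- V9 | P z].

(** Once y is dominated from elsewhere, one vertex w finishes the set. The last clause is for
    [nine_side]: under maximum degree 4, only vertices of degree at most 3 inside can have
    neighbours outside, and at most one of them survives. *)
Definition remove9 : bool :=
  all (fun y => has (fun w =>
    let P z := (z != y) && ~~ dom9 w z in
    square_free9 P && ((deg9 y <= 3) ==> at_most_one9 (fun z => P z && (deg9 z <= 3))))
    V9) V9.

Definition cover9 : bool :=
  all (fun y => has (fun w => at_most_one9 (fun z => ~~ dom9 y z && ~~ dom9 w z)) V9) V9.

Definition degrees9 : bool :=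
  all (fun v => 3 <= deg9 v) V9 && has (fun v => deg9 v == 4) V9.

(** An x dominated by v in this way is a twin of v. The vertices u and t are for [deg_le4], where u
    takes over the role of v and t shows that a second bad component borders a common vertex. *)
Definition twin9 : bool :=
  all (fun v => all (fun x =>
      all (dom9 x) [seq u <- V9 | r v u] &&
      has (fun u => [&& r v u, u != x, deg9 u == 4 &
        has (fun t => [&& r v t, t != u & ~~ r u t]) V9]) V9)
    [seq x <- V9 | r v x && all (dom9 v) [seq u <- V9 | r x u]])
    [seq v <- V9 | deg9 v == 4].

(** For [two_comps]: a neighbour x of v cannot stay unattached to a C4 that avoids N[v]. *)
Definition attach9 : bool :=
  all (fun v => all (fun x => square_free9 (fun z => ~~ dom9 v z && ~~ r x z))
    [seq x <- V9 | r v x]) [seq v <- V9 | deg9 v == 3].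

(** For the last case of [no_deg4]: t keeps a degree too small for a bad set of nine vertices. *)
Definition far9 : bool :=
  all (fun x => has (fun v => [&& deg9 v == 4, v != x, ~~ r v x &
      has (fun t => [&& t != x, ~~ dom9 v t &
         count (fun s => r t s && ~~ dom9 v s) V9 <= 2]) V9]) V9)
    [seq x <- V9 | deg9 x <= 3].

End NineFacts.

Lemma nine_facts k : k < 6 -> let r := nine_entry k in
  [/\ remove9 r, cover9 r, degrees9 r & [/\ twin9 r, attach9 r & far9 r]].
Proof.
have F : all (fun k => let r := nine_entry k in
  [&& remove9 r, cover9 r, degrees9 r, twin9 r, attach9 r & far9 r]) (iota 0 6).
  by vm_compute.
move=> ltk; have /allP/(_ k) := F; rewrite mem_iota ltk => /(_ isT).
case/and5P=> f1 f2 f3 f4 /andP[f5 f6].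
exact: And4 f1 f2 f3 (And3 f4 f5 f6).
Qed.

Lemma all9 (P : pred nat) (i : 'I_9) : all P (iota 0 9) -> P i.
Proof. by move=> /all_iota9P; apply. Qed.

Lemma has9 (P : pred nat) : has P (iota 0 9) -> exists i : 'I_9, P i.
Proof. by case/hasP => i; rewrite mem_iota => lti Pi; exists (Ordinal lti). Qed.

Lemma all9_filter (P Q : pred nat) (i : 'I_9) :
  all P [seq j <- iota 0 9 | Q j] -> Q i -> P i.
Proof. by move/allP=> PQ Qi; apply: PQ; rewrite mem_filter Qi mem_iota ltn_ord. Qed.

Lemma at_most_one9P (P : pred nat) (i j : 'I_9) : at_most_one9 P -> P i -> P j -> i = j.
Proof.
move=> P1 Pi Pj; have /eqP ji := all9_filter (all9_filter P1 Pi) Pj.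
by apply: val_inj; rewrite [RHS]ji.
Qed.

Lemma square_free9P r (P : pred nat) (a b c d : 'I_9) : square_free9 r P ->
  P a -> P b -> P c -> P d -> r a b -> r b c -> r c d -> r d a -> a != c -> b != d -> False.
Proof.
move=> sf Pa Pb Pc Pd ab bc cd da ac bd.
have sfa := all9_filter sf Pa.
have sfb := all9_filter (i := b) sfa; rewrite Pb ab in sfb.
have sfc := all9_filter (i := c) (sfb isT); rewrite Pc bc (inj_eq val_inj) eq_sym ac in sfc.
have : (d : nat) \in [seq d <- iota 0 9 | [&& P d, r c d, r d a & d != b]].
  by rewrite mem_filter Pd cd da (inj_eq val_inj) eq_sym bd mem_iota ltn_ord.
by rewrite (nilP (sfc isT)).
Qed.

Section BadGraphs.
Variables (T : finType) (e : rel T).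
Hypotheses (e_sym : symmetric e) (e_irr : irreflexive e).
Implicit Types (A B C D S Z H K J W Y : {set T}) (u v w x y z : T).

Notation nbh := (closed_nbhd e).
Notation nb := (nb e).
Notation bad := (bad e).
Notation isol := (isol e).
Notation C4_in := (C4_in e).
Notation is_C4 := (is_C4 e).

Lemma nbh0 : nbh set0 = set0.
Proof. by apply/setP => v; rewrite [RHS]inE; apply/negP => /nbhP[u]; rewrite inE. Qed.

Lemma bad_C4 A : bad A -> C4_in A.
Proof.
move=> /badP[_ noD]; apply: contraT => nC; have := noD set0.
by rewrite cards0 muln0 /isol nbh0 setD0 => /(_ nC).
Qed.

Lemma C4_uniq a b c d : is_C4 a b c d -> uniq [:: a; b; c; d].
Proof.
by case/andP=> /and5P[? ? ? ? /andP[? ?]] _; rewrite /= !inE !negb_or; do ![apply/andP; split=> //].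
Qed.

Lemma C4_card A a b c d : is_C4 a b c d -> a \in A -> b \in A -> c \in A -> d \in A ->
  4 <= #|A|.
Proof.
move=> /C4_uniq /card_uniqP cU aA bA cA dA; rewrite -[4]cU.
by apply: subset_leq_card; rewrite subset_all /= aA bA cA dA.
Qed.

Lemma C4_set A a b c d : is_C4 a b c d -> #|A| = 4 -> a \in A -> b \in A -> c \in A -> d \in A ->
  A = [set a; b; c; d].
Proof.
move=> /C4_uniq /card_uniqP cU c4 aA bA cA dA; apply/esym/eqP.
rewrite eqEcard !subUset !sub1set aA bA cA dA c4 /=.
rewrite -[4]cU subset_leq_card //; apply/subsetP => x.
by rewrite !inE -!orbA.
Qed.

Lemma bad4P A y : bad A -> #|A| = 4 -> y \in A ->
  exists p z q, is_C4 y p z q /\ A = [set y; p; z; q].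
Proof.
move=> /bad_C4/C4P[a [b [c [d [aA bA cA dA sq]]]]] c4.
rewrite (C4_set sq c4 aA bA cA dA) => yA.
have rot p q s t : is_C4 p q s t -> [set p; q; s; t] = [set a; b; c; d] ->
    exists p' z q', is_C4 p p' z q' /\ [set a; b; c; d] = [set p; p'; z; q'].
  by move=> sq' E; exists q, s, t.
have sq2 := sq; rewrite C4_rot in sq2; have sq3 := sq2; rewrite C4_rot in sq3.
have sq4 := sq3; rewrite C4_rot in sq4.
move: yA; rewrite !inE -!orbA => /or4P[] /eqP->.
- exact: rot sq _.
- by apply: rot sq2 _; apply/setP => i; rewrite !inE; do !case: (_ == _).
- by apply: rot sq3 _; apply/setP => i; rewrite !inE; do !case: (_ == _).
- by apply: rot sq4 _; apply/setP => i; rewrite !inE; do !case: (_ == _).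
Qed.

Lemma C4_conn a b c d : is_C4 a b c d -> conn e [set a; b; c; d].
Proof.
case/andP=> _ /and4P[ab bc cd da].
have aA : a \in [set a; b; c; d] by rewrite !inE eqxx.
apply/(connP e_sym aA) => S aS cl.
have bS : b \in S by apply: (cl a b); rewrite ?inE ?eqxx ?orbT.
have cS : c \in S by apply: (cl b c); rewrite ?inE ?eqxx ?orbT.
have dS : d \in S by apply: (cl c d); rewrite ?inE ?eqxx ?orbT.
by rewrite !subUset !sub1set aS bS cS dS.
Qed.

Lemma bad4I A : #|A| = 4 -> C4_in A -> bad A.
Proof.
move=> c4 C4A; apply/andP; split.
  have /C4P[a [b [c [d [aA bA cA dA sq]]]]] := C4A.
  by rewrite (C4_set sq c4 aA bA cA dA) C4_conn.
apply/existsPn => D; rewrite c4; apply/negP => /andP[iD].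
case: (posnP #|D|) => [/eqP|]; last lia.
by rewrite cards_eq0 => /eqP E; move: iD; rewrite E /isol nbh0 setD0 C4A.
Qed.

(** A single vertex is within the budget, as 5 is at most 9, so it cannot isolate a bad set. *)
Lemma bad9_C4 A v : bad A -> #|A| = 9 -> C4_in (A :\: nbh [set v]).
Proof.
move=> /badP[_ noD] c9; apply: contraT => iv.
by have := noD [set v] iv; rewrite cards1 c9.
Qed.

Definition nine_labelled A (h : 'I_9 -> T) (r : nat -> nat -> bool) : Prop :=
  [/\ injective h, A = h @: setT & forall i j : 'I_9, e (h i) (h j) = r i j].

Lemma bad9_adj A : bad A -> #|A| = 9 ->
  exists k h, k < 6 /\ nine_labelled A h (nine_entry k).
Proof.
move=> bA c9; have /badP[cA _] := bA.
have [v vA] : exists v, v \in A by apply/set0Pn; rewrite -card_gt0 c9.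
have /C4P[a [b [c [d]]]] := bad9_C4 v bA c9.
rewrite !in_setD !nbh1 !negb_or -!andbA => -[/and3P[av va aA] /and3P[bv vb bA'] /and3P[cv vc cA'] /and3P[dv vd dA] sq].
pose s := enum (A :\: [set v; a; b; c; d]).
(* The labelling expected by the root state: [v] is 0, and a C4 avoiding its closed neighbourhood is
   5, 6, 7, 8. *)
pose l := v :: s ++ [:: a; b; c; d].
have uabcd := C4_uniq sq.
have suni : uniq l.
  rewrite /l cons_uniq cat_uniq enum_uniq uabcd mem_cat mem_enum !inE eqxx /=.
  rewrite ![v == _]eq_sym (negbTE av) (negbTE bv) (negbTE cv) (negbTE dv) /=.
  by rewrite !mem_enum !inE !eqxx ?orbT.
have memA x : (x \in l) = (x \in A).
  rewrite /l inE mem_cat mem_enum !inE.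
  apply/idP/idP => [/orP[/eqP->//|/orP[/andP[]//|/or4P[] /eqP->//]]|->].
  by do !case: (_ == _).
have sl : size l = 9.
  by rewrite -c9 -(card_uniqP suni); apply: eq_card => x; rewrite memA.
have ss : size s = 4 by move/eqP: sl; rewrite /l /= size_cat addn4 !eqSS => /eqP.
pose r i j := e (nth v l i) (nth v l j).
have g9 i : i < 9 -> nth v l i \in A by move=> lti; rewrite -memA mem_nth ?sl.
have ilt x : x \in A -> index x l < 9 by rewrite -memA -index_mem sl.
have nthi x : x \in A -> nth v l (index x l) = x by rewrite -memA; apply: nth_index.
have r_sym : symmetric r by move=> i j; rewrite /r e_sym.
have r_irr : irreflexive r by move=> i; rewrite /r e_irr.
have [||u ltu|S S0 [j ltj jS]|k [f [ltk pf Hf]]] := nine_classification r_sym r_irr.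
- rewrite /r /l; move: s ss {suni memA sl r_sym r_irr r l ilt nthi g9} => [|s1 [|s2 [|s3 [|s4 [|]]]]] //= _.
  by case/andP: sq.
- rewrite /r /l; move: s ss {suni memA sl r_sym r_irr r l ilt nthi g9} => [|s1 [|s2 [|s3 [|s4 [|]]]]] //= _.
  by rewrite va vb vc vd.
- have /C4P[a' [b' [c' [d']]]] := bad9_C4 (nth v l u) bA c9.
  rewrite !in_setD !nbh1 !negb_or -!andbA.
  move=> [/and3P[au ua aA1] /and3P[bu ub bA1] /and3P[cu uc cA1] /and3P[du ud dA1] sq'].
  have uu := C4_uniq sq'; have /andP[_ sq''] := sq'.
  exists (index a' l), (index b' l), (index c' l), (index d' l).
  rewrite /square_at /r !nthi // !ilt // sq'' ua ub uc ud /= andbT.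
  have neqi x : x \in A -> x != nth v l u -> (u == index x l) = false.
    move=> xA; apply: contraNF => /eqP E; rewrite E nthi //.
  rewrite !inE !neqi //= .
  have ieq x y : x \in A -> y \in A -> (index x l == index y l) = (x == y).
    by move=> xA yA; apply/eqP/eqP => [E|->//]; rewrite -(nthi x xA) E nthi.
  by rewrite !ieq //; move: uu; rewrite /= !inE.
(* A set of labels containing 0 and missing another label is a proper cut of the connected set
   [A]. *)
- pose X := [set x in A | index x l \in S].
  have /forallP/(_ X)/implyP cAX := cA.
  have vX : v \in X by rewrite inE vA /l /= eqxx.
  have /cAX/existsP[x /andP[]] : [&& X \subset A, X != set0 & X != A].
    apply/and3P; split; first by apply/subsetP => x; rewrite inE => /andP[].
      by apply/set0Pn; exists v.
    apply: contraNneq jS => XA; have := g9 j ltj.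
    by rewrite -XA inE index_uniq ?sl // => /andP[].
  rewrite inE => /andP[xA xS] /existsP[y /andP[]]; rewrite !inE negb_and => /andP[+ yA] xy.
  rewrite yA /= => yS; exists (index x l), (index y l).
  by rewrite xS ilt // yS /r !nthi.
pose h (i : 'I_9) := nth v l (nth 0 f i).
have f9 (i : 'I_9) : nth 0 f i < 9.
  have sf : size f = 9 by rewrite (perm_size pf).
  by have := mem_nth 0 (_ : i < size f); rewrite sf (perm_mem pf) mem_iota => /(_ (ltn_ord i)).
have hinj : injective h.
  move=> i j /eqP; rewrite /h nth_uniq ?sl ?f9 // nth_uniq ?(perm_size pf) //.
    by move/eqP/val_inj.
  by rewrite (perm_uniq pf) iota_uniq.
exists k, h; split=> //; split=> //.
  apply/esym/eqP; rewrite eqEcard card_imset // cardsT card_ord c9 leqnn andbT.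
  by apply/subsetP => _ /imsetP[i _ ->]; apply: g9.
by move=> i j; rewrite -Hf.
Qed.

Definition degin A v : nat := #|nb v :&: A|.

Lemma bad9P A : bad A -> #|A| = 9 -> exists h r, nine_labelled A h r /\
  [/\ remove9 r, cover9 r, degrees9 r & [/\ twin9 r, attach9 r & far9 r]].
Proof.
move=> bA c9; have [k [h [ltk [hinj hA he]]]] := bad9_adj bA c9.
by exists h, (nine_entry k); split; last exact: nine_facts.
Qed.

Section Labelled.
Variables (A : {set T}) (h : 'I_9 -> T) (r : nat -> nat -> bool).
Hypothesis Ahr : nine_labelled A h r.

Lemma lab_ex x : x \in A -> exists i, x = h i.
Proof. by case: Ahr => _ -> _ /imsetP[i _ ->]; exists i. Qed.

Lemma lab_in i : h i \in A.
Proof. by case: Ahr => _ -> _; apply: imset_f. Qed.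

Lemma lab_e i j : e (h i) (h j) = r i j. Proof. by case: Ahr. Qed.

Lemma lab_eq i j : (h i == h j) = (i == j :> nat).
Proof. by case: Ahr => hi _ _; rewrite (inj_eq hi). Qed.

Lemma lab_nbh i j : (h j \in nbh [set h i]) = dom9 r i j.
Proof. by rewrite nbh1 lab_eq eq_sym lab_e. Qed.

Lemma lab_count (P : pred T) (Q : pred nat) : (forall i : 'I_9, P (h i) = Q i) ->
  #|[set x in A | P x]| = count Q (iota 0 9).
Proof.
move=> PQ; have [hinj hA _] := Ahr.
have -> : [set x in A | P x] = h @: [set i : 'I_9 | Q i].
  apply/setP => x; rewrite inE; apply/andP/imsetP => [[/lab_ex[i ->]]|[i Qi ->]].
    by rewrite PQ => Qi; exists i; rewrite ?inE.
  by rewrite lab_in PQ; rewrite inE in Qi.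
rewrite card_imset // cardsE cardE -(size_map val) -val_enum_ord -size_filter filter_map.
by rewrite /enum_mem size_map size_map -enumT /= /enum_mem -filter_predI; congr size; apply: eq_filter => i /=; rewrite andbT.
Qed.

Lemma lab_degin i : degin A (h i) = deg9 r i.
Proof.
rewrite /degin /deg9 -(lab_count (P := e (h i))) => [|j]; last exact: lab_e.
by congr #|pred_of_set _|; apply/setP => x; rewrite !inE andbC.
Qed.

End Labelled.

Lemma bad9_remove A y : bad A -> #|A| = 9 -> y \in A ->
  exists w, [/\ w \in A, isol (A :\ y) [set w] & degin A y <= 3 ->
    forall z z', z \in A -> z' \in A -> z != y -> z' != y ->
      z \notin nbh [set w] -> z' \notin nbh [set w] ->
      degin A z <= 3 -> degin A z' <= 3 -> z = z'].
Proof.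
move=> bA c9; have [h [r [Ahr [F _ _ _]]]] := bad9P bA c9.
case/(lab_ex Ahr) => i ->; have /has9[j /andP[sf am]] := all9 i F.
exists (h j); split; first exact: lab_in Ahr j.
  apply: isol_intro => a b c d sq; rewrite !in_setD1 => /andP[+ /(lab_ex Ahr)[a' Ea]].
  move=> + /andP[+ /(lab_ex Ahr)[b' Eb]] /andP[+ /(lab_ex Ahr)[c' Ec]] /andP[+ /(lab_ex Ahr)[d' Ed]].
  have /andP[/and5P[_ + _ _ /andP[+ _]] /and4P[]] := sq.
  rewrite Ea Eb Ec Ed !(lab_eq Ahr) !(lab_e Ahr) !(lab_nbh Ahr) => ac bd ab bc cd da ai bi ci di aj bj cj dj.
  apply: (square_free9P sf _ _ _ _ ab bc cd da ac bd); exact/andP.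
rewrite (lab_degin Ahr) => di z z' /(lab_ex Ahr)[a ->] /(lab_ex Ahr)[b ->].
rewrite !(lab_eq Ahr) !(lab_nbh Ahr) !(lab_degin Ahr) => ai bi aj bj da db.
have {}am := implyP am di.
by congr h; apply: at_most_one9P am _ _; rewrite ?ai ?bi ?aj ?bj.
Qed.

Lemma bad9_cover A y : bad A -> #|A| = 9 -> y \in A ->
  exists w, w \in A /\ forall z z', z \in A -> z' \in A ->
      z \notin nbh [set y] -> z' \notin nbh [set y] ->
      z \notin nbh [set w] -> z' \notin nbh [set w] -> z = z'.
Proof.
move=> bA c9; have [h [r [Ahr [_ F _ _]]]] := bad9P bA c9.
case/(lab_ex Ahr) => i ->; have /has9[j am] := all9 i F.
exists (h j); split=> [|z z' /(lab_ex Ahr)[a ->] /(lab_ex Ahr)[b ->]]; first exact: lab_in Ahr j.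
rewrite !(lab_nbh Ahr) => ai bi aj bj; congr h.
by apply: at_most_one9P am _ _; rewrite ?ai ?bi ?aj ?bj.
Qed.

Lemma bad9_mindeg A y : bad A -> #|A| = 9 -> y \in A -> 3 <= degin A y.
Proof.
move=> bA c9; have [h [r [Ahr [_ _ /andP[F _] _]]]] := bad9P bA c9.
by case/(lab_ex Ahr) => i ->; rewrite (lab_degin Ahr); apply: all9 i F.
Qed.

Lemma bad9_deg4 A : bad A -> #|A| = 9 -> exists2 y, y \in A & degin A y = 4.
Proof.
move=> bA c9; have [h [r [Ahr [_ _ /andP[_ /has9[i /eqP F]] _]]]] := bad9P bA c9.
by exists (h i); [apply: lab_in Ahr i | rewrite (lab_degin Ahr)].
Qed.

Lemma bad9_twin A v x : bad A -> #|A| = 9 -> v \in A -> degin A v = 4 -> x \in A ->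
  e v x -> (forall u, u \in A -> e x u -> u \in nbh [set v]) ->
  (forall u, u \in A -> e v u -> u \in nbh [set x]) /\
  exists u t, [/\ u \in A, e v u, u != x & degin A u = 4] /\
              [/\ t \in A, e v t, t != u & ~~ e u t].
Proof.
move=> bA c9; have [h [r [Ahr [_ _ _ [F _ _]]]]] := bad9P bA c9.
case/(lab_ex Ahr) => i -> /eqP di /(lab_ex Ahr)[j ->] ij sub.
rewrite (lab_degin Ahr) in di; rewrite (lab_e Ahr) in ij.
have F1 := all9_filter F di.
have /andP[tw /has9[u /and4P[iu uj du /has9[t /and3P[it tu ut]]]]] : 
    all (dom9 r j) [seq u : nat <- iota 0 9 | r i u] && has (fun u : nat => [&& r i u, u != j, deg9 r u == 4 &
        has (fun t : nat => [&& r i t, t != u & ~~ r u t]) (iota 0 9)]) (iota 0 9).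
  apply: (all9_filter (i := j) F1); rewrite ij; apply/allP => u.
  rewrite mem_filter mem_iota => /andP[ju /= ltu].
  have := sub (h (Ordinal ltu)) (lab_in Ahr _).
  by rewrite (lab_e Ahr) (lab_nbh Ahr) => /(_ ju).
split=> [w /(lab_ex Ahr)[a ->]|].
  by rewrite (lab_e Ahr) (lab_nbh Ahr) => ia; apply: (all9_filter (i := a) tw).
exists (h u), (h t); rewrite !(lab_in Ahr) !(lab_e Ahr) !(lab_eq Ahr) (lab_degin Ahr).
by split; split=> //; apply/eqP.
Qed.

Lemma bad9_attach A v x a b c d : bad A -> #|A| = 9 -> v \in A -> degin A v = 3 ->
  x \in A -> e v x -> is_C4 a b c d ->
  a \in A -> b \in A -> c \in A -> d \in A ->
  a \notin nbh [set v] -> b \notin nbh [set v] ->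
  c \notin nbh [set v] -> d \notin nbh [set v] ->
  [|| e x a, e x b, e x c | e x d].
Proof.
move=> bA c9; have [h [r [Ahr [_ _ _ [_ F _]]]]] := bad9P bA c9.
case/(lab_ex Ahr) => i -> /eqP di /(lab_ex Ahr)[j ->] + sq.
have /andP[/and5P[_ + _ _ /andP[+ _]] /and4P[]] := sq.
move=> + + + + + + + /(lab_ex Ahr)[a' Ea] /(lab_ex Ahr)[b' Eb] /(lab_ex Ahr)[c' Ec] /(lab_ex Ahr)[d' Ed].
rewrite (lab_degin Ahr) in di; rewrite Ea Eb Ec Ed.
rewrite !(lab_e Ahr) !(lab_eq Ahr) !(lab_nbh Ahr) => ac bd ab bc cd da ij ia ib ic id.
have sf := all9_filter (i := j) (all9_filter (i := i) F di) ij.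
apply: contraT; rewrite !negb_or => /and4P[ja jb jc jd].
by case: (square_free9P sf _ _ _ _ ab bc cd da ac bd); apply/andP.
Qed.

Lemma bad9_far A x : bad A -> #|A| = 9 -> x \in A -> degin A x <= 3 ->
  exists v t, [/\ v \in A, degin A v = 4, v != x & ~~ e v x] /\
    [/\ t \in A, t != x, t \notin nbh [set v] & degin (A :\: nbh [set v]) t <= 2].
Proof.
move=> bA c9; have [h [r [Ahr [_ _ _ [_ _ F]]]]] := bad9P bA c9.
case/(lab_ex Ahr) => i ->; rewrite (lab_degin Ahr) => di.
have /has9[v /and4P[/eqP dv vi nvi /has9[t /and3P[ti vt ct]]]] := all9_filter (i := i) F di.
exists (h v), (h t).
rewrite !(lab_in Ahr) !(lab_e Ahr) !(lab_eq Ahr) (lab_degin Ahr) (lab_nbh Ahr).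
split; split=> //; apply: leq_trans ct.
rewrite -(lab_count Ahr (P := fun s => e (h t) s && (s \notin nbh [set h v]))).
  by apply: subset_leq_card; apply/subsetP => s; rewrite !inE => /andP[-> /andP[-> ->]].
by move=> s; rewrite (lab_e Ahr) (lab_nbh Ahr).
Qed.

(** A C4 outside N[y] occupies four of the nine vertices, which leaves at most five for N[y]. *)
Lemma bad9_maxdeg A y : bad A -> #|A| = 9 -> y \in A -> degin A y <= 4.
Proof.
move=> bA c9 yA; have /C4P[a [b [c [d [aA bA' cA dA sq]]]]] := bad9_C4 y bA c9.
have := C4_card sq aA bA' cA dA.
have := cardsID (nbh [set y]) A; rewrite c9.
have : #|A :&: nbh [set y]| = (degin A y).+1.
  by rewrite nbh1E setIUr (setIidPr _) ?sub1set // cardsU1 !inE e_irr andbF setIC.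
by move=> -> /=; lia.
Qed.

Lemma bad_maxdeg A y : bad A -> #|A| = 4 \/ #|A| = 9 -> y \in A ->
  degin A y <= 4 /\ (#|A| = 4 -> degin A y <= 3).
Proof.
move=> bA [c4|c9] yA; last by split; [apply: bad9_maxdeg | rewrite c9].
suff le3 : degin A y <= 3 by split=> //; apply: leqW.
rewrite -ltnS -c4 proper_card //; apply/properP; split; first exact: subsetIr.
by exists y; rewrite // !inE e_irr.
Qed.

Definition small A := #|A| = 4 \/ #|A| = 9.

(** The saving from a dominated vertex y: in order 4 three vertices remain and no choice is made, in
    order 9 one vertex suffices instead of two. *)
Lemma bad_touched A y : bad A -> small A -> y \in A ->
  exists2 W : {set T}, isol (A :\ y) W & 5 * #|W| + 4 = #|A|.
Proof.
move=> bA [c4|c9] yA; last first.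
  by have [w [_ iw _]] := bad9_remove bA c9 yA; exists [set w]; rewrite // cards1 c9.
exists set0; rewrite ?cards0 ?c4 //; apply: isol_intro => a b c d sq aA bA' cA dA _ _ _ _.
have := C4_card sq aA bA' cA dA.
by have := cardsD1 y A; rewrite yA c4 add1n => -[<-].
Qed.

(** In order 4 only the vertex opposite to y on the C4 can escape N[y]; order 9 is [cover9]. The
    count matters in [side_bad]: |A| + 1 = 5(|W| + 1). *)
Lemma bad_cover A y : bad A -> small A -> y \in A ->
  exists2 W : {set T}, 5 * #|W| + 4 = #|A| &
    forall z z', z \in A -> z' \in A -> z \notin nbh (y |: W) -> z' \notin nbh (y |: W) -> z = z'.
Proof.
move=> bA [c4|c9] yA; last first.
  have [w [_ am]] := bad9_cover bA c9 yA; exists [set w]; rewrite ?cards1 ?c9 // => z z' zA z'A.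
  by rewrite nbhU !in_setU !negb_or => /andP[? ?] /andP[? ?]; apply: am.
exists set0; rewrite ?cards0 ?c4 // => z z'; rewrite setU0 !nbh1 !negb_or.
have [p [s [q [sq ->]]]] := bad4P bA c4 yA.
have /andP[_ /and4P[yp _ _ qy]] := sq; rewrite e_sym in qy.
by rewrite !inE -!orbA => /or4P[] /eqP-> /or4P[] /eqP-> //; rewrite ?eqxx ?yp ?qy ?andbF.
Qed.

End BadGraphs.

(** * A smallest counterexample *)

Section Minimal.
Variables (T : finType) (e : rel T).
Hypotheses (e_sym : symmetric e) (e_irr : irreflexive e).
Implicit Types (A B C D S Z H K J W Y : {set T}) (u v w x y z : T).

Notation nbh := (closed_nbhd e).
Notation nb := (nb e).
Notation bad := (bad e).
Notation isol := (isol e).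
Notation C4_in := (C4_in e).
Notation is_C4 := (is_C4 e).
Notation conn := (conn e).
Notation is_comp := (is_comp e).
Notation ncomp := (ncomp e).
Notation bdry := (bdry e).
Notation touched := (touched e).
Notation degin := (degin e).

Hypothesis T_bad : bad setT.
Hypothesis small_bad : forall A, bad A -> A != setT -> small A.
Hypothesis T_big : ~ small (setT : {set T}).

(* Once D is chosen, Y can be discarded. *)
Definition valid D Y : Prop := forall a b c d, is_C4 a b c d ->
  a \notin nbh D -> b \notin nbh D -> c \notin nbh D -> d \notin nbh D -> a \notin Y.

Lemma bdryP A x : reflect (x \notin A /\ exists2 y, y \in A & e y x) (x \in bdry A).
Proof.
rewrite inE; apply: (iffP andP) => -[xA].
  by case/exists_inP=> y yA yx; split=> //; exists y.
by case=> y yA yx; split=> //; apply/exists_inP; exists y.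
Qed.

Lemma T_conn : conn setT. Proof. by case/badP: T_bad. Qed.

Lemma T_no D : isol setT D -> #|T| < 5 * #|D|.
Proof. by move=> iD; have [_ /(_ D iD)] := badP T_bad; rewrite cardsT. Qed.

Lemma exit_edge A x y : x \in A -> y \notin A -> exists u v, [/\ u \in A, v \notin A & e u v].
Proof.
move=> xA yA; have [/exists_inP[u uA /exists_inP[v]]|no] :=
  boolP [exists u in A, exists v in ~: A, e u v].
  by rewrite inE => vA uv; exists u, v.
suff /subsetP/(_ y (in_setT y)) : setT \subset A by rewrite (negbTE yA).
apply: (connP e_sym (in_setT x) T_conn) => // u v _ _ uA; apply: contraTT => vA.
apply: contra no => uv; apply/exists_inP; exists u => //.
by apply/exists_inP; exists v; rewrite ?inE.
Qed.

(* The isolating set takes D0 and then treats the components of Z one by one; a bad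
   component that D0 already touches costs one vertex less. *)
Lemma extend_isol Z D0 : Z != setT -> exists D,
  isol Z (D0 :|: D) /\ 5 * #|D| + 5 * ncomp (touched D0) Z <= #|Z| + ncomp bad Z.
Proof.
have [n] := ubnP #|Z|; elim: n Z => // n IH Z leZn ZT.
have [->|/set0Pn[x xZ]] := eqVneq Z set0.
  exists set0; split.
    by apply: isol_intro => a b c d _; rewrite inE.
  rewrite cards0 ncomp_eq0 // => C /is_compP[/subsetP C0 /set0Pn[x /C0]].
  by rewrite inE.
have [C cC xC] := comp_exists e_sym xZ; have /is_compP[CZ _ kC clC] := cC.
have CT : C != setT by apply: contraNneq ZT => CE; rewrite eqEsubset subsetT -CE.
have cardZ : #|Z| = #|C| + #|Z :\: C| by rewrite -(cardsID C Z) (setIidPr CZ).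
have [||D' [iD' leD']] := IH (Z :\: C).
- have C0 : 0 < #|C| by apply/card_gt0P; exists x.
  by lia.
- by apply: contraNneq ZT => ZE; rewrite eqEsubset subsetT -ZE subsetDl.
(* The cost of the single component [C]; the booleans are its contributions to the two counts. *)
suff [D1 iD1 leD1] : exists2 D1, isol C (D0 :|: D1) &
    5 * #|D1| + 5 * touched D0 C <= #|C| + bad C.
  exists (D1 :|: D'); split.
    have -> : D0 :|: (D1 :|: D') = (D0 :|: D1) :|: (D0 :|: D') by rewrite setUACA setUid.
    rewrite -(setID Z C) (setIidPr CZ); apply: (isolU e_sym) => // u v uC.
    rewrite inE => /andP[vC vZ]; apply: contra vC; exact: clC.
  rewrite !(ncompD e_sym _ cC) cardZ; move: leD1 leD' (leq_card_setU D1 D').1.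
  move: (nat_of_bool _) (nat_of_bool _) (ncomp _ _) (ncomp _ _) #|_| #|_| #|_|.
  by clear => *; lia.
have [bC|nbC] := boolP (bad C); last first.
  have [D1 iD1 le1] := nbad_isol kC nbC; exists D1.
    exact: isol_mono (subxx _) (subsetUr _ _) iD1.
  by rewrite /touched (negbTE nbC) muln0 !addn0.
have sC := small_bad bC CT.
have [yes|no] := boolP (touched D0 C).
  have /andP[_ /pred0Pn[y /andP[/= yC yD]]] := yes.
  have [W iW cW] := bad_touched e_sym e_irr bC sC yC; exists W; last first.
    by move: #|W| #|C| cW; clear; lia.
  apply: isol_intro => a b c d sq aC bC' cC' dC aD bD cD dD.
  move: aD bD cD dD; rewrite nbhU !in_setU !negb_or.
  move=> /andP[aD aW] /andP[bD bW] /andP[cD cW'] /andP[dD dW].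
  case/negP: iW; apply/C4P; exists a, b, c, d.
  have neq z : z \notin nbh D0 -> z != y by apply: contraNneq => ->.
  by rewrite !in_setD !in_set1 !neq // aW bW cW' dW.
(* An untouched bad component pays for one arbitrary vertex of its own and is then handled like a
   touched one. *)
have [W iW cW] := bad_touched e_sym e_irr bC sC xC; exists (x |: W); last first.
  rewrite cardsU1.
  by move: (x \notin W) #|W| #|C| cW; clear => -[]; lia.
apply: isol_intro => a b c d sq aC bC' cC' dC aD bD cD dD.
move: aD bD cD dD; rewrite !nbhU !in_setU !negb_or !nbh1 !negb_or.
move=> /and3P[_ /andP[ax _] aW] /and3P[_ /andP[bx _] bW] /and3P[_ /andP[cx _] cW'] /and3P[_ /andP[dx _] dW].
case/negP: iW; apply/C4P; exists a, b, c, d.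
by rewrite !in_setD !in_set1 ax bx cx dx aW bW cW' dW.
Qed.

Notation nbad := (ncomp bad).

(** Otherwise [D] and the set supplied by [extend_isol] for the complement of [Y] would isolate the
    whole graph within the budget. *)
Lemma tool D Y : Y != set0 -> valid D Y ->
  #|Y| + 5 * ncomp (touched D) (~: Y) < 5 * #|D| + nbad (~: Y).
Proof.
move=> Y0 val; have [|D' [iD leD]] := @extend_isol (~: Y) D.
  by apply: contraNneq Y0 => YT; rewrite -(setCK Y) YT setCT.
have /T_no : isol setT (D :|: D').
  apply: isol_intro => a b c d sq _ _ _ _ aD bD cD dD; case/negP: iD.
  have out z : z \notin nbh (D :|: D') -> z \notin nbh D.
    by rewrite nbhU in_setU negb_or => /andP[].
  (* [valid] concerns the first vertex of a C4 only; the rotations give the other three. *)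
  have sq2 := sq; rewrite C4_rot in sq2; have sq3 := sq2; rewrite C4_rot in sq3.
  have sq4 := sq3; rewrite C4_rot in sq4.
  apply/C4P; exists a, b, c, d; rewrite !in_setD !in_setC aD bD cD dD /=.
  split=> //; [apply: (val a b c d)|apply: (val b c d a)|apply: (val c d a b)|apply: (val d a b c)] => //; exact: out.
move: leD (leq_card_setU D D').1 (cardsC Y).
by move: #|D :|: D'| #|D| #|D'| #|Y| #|~: Y| (ncomp _ _) (ncomp _ _) => *; lia.
Qed.

Lemma bad_n0 A : bad A -> exists x, x \in A.
Proof. by move/bad_C4/C4P => [a [b [c [d [aA _ _ _ _]]]]]; exists a. Qed.

Lemma comp_exit Y C y : is_comp (~: Y) C -> y \in Y -> exists u v, [/\ u \in C, v \in Y & e u v].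
Proof.
case/is_compP => CY /set0Pn[x xC] _ cl yY.
have yC : y \notin C by apply/negP => /(subsetP CY); rewrite inE yY.
have [u [v [uC vC uv]]] := exit_edge xC yC; exists u, v; split=> //.
by apply: contraNT vC => vY; apply: cl uC _ uv; rewrite inE.
Qed.

(* Otherwise x touches a bad component of G - x. *)
Lemma one_link C x : bad C -> x \notin C ->
  (forall u v, u \in C -> v \notin C -> e u v -> v = x) -> False.
Proof.
move=> bC xC link.
have cC : is_comp (~: [set x]) C.
  have [cC _] := badP bC; have [y yC] := bad_n0 bC.
  apply/is_compP; split=> //.
  - by apply/subsetP => z zC; rewrite !inE; apply: contraNneq xC => <-.
  - by apply/set0Pn; exists y.
  - move=> u v uC; rewrite !inE => vx uv; apply: contraNT vx => vC.
    by apply/eqP/(link u).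
have x0 : [set x] != set0 by apply/set0Pn; exists x; rewrite set11.
have val : valid [set x] [set x].
  by move=> a b c d _ + _ _ _; apply: contra; apply: (subsetP (sub_nbh _ _)).
have := tool x0 val; rewrite !cards1 (@ncomp_eq _ _ (touched [set x]) bad) => [|B cB].
  have : 0 < nbad (~: [set x]) by apply/card_gt0P; exists C; rewrite inE cC.
  by move: (ncomp _ _); clear => *; lia.
rewrite /touched; have [u [v [uB /set1P-> ux]]] := comp_exit cB (set11 x).
suff -> : ~~ [disjoint B & nbh [set x]] by rewrite andbT.
by apply/pred0Pn; exists u; rewrite /= uB nbh1 e_sym ux orbT.
Qed.

Lemma bdry_comp Y C : is_comp (~: Y) C -> bdry C \subset Y.
Proof.
case/is_compP => _ _ _ cl; apply/subsetP => x /bdryP[xC [y yC yx]].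
by apply: contraNT xC => xY; apply: cl yC _ yx; rewrite inE.
Qed.

Lemma bad_bdry C : bad C -> C != setT -> 2 <= #|bdry C|.
Proof.
move=> bC CT; rewrite ltnNge; apply/negP => le1.
have [x xC lx] : exists2 x, x \notin C & bdry C \subset [set x].
  have [b0|/set0Pn[x xb]] := eqVneq (bdry C) set0.
    have [x xC] : exists x, x \notin C.
      by apply/existsP; apply: contraNT CT; rewrite negb_exists => /forallP CT;
        apply/eqP/setP => z; rewrite inE -[LHS]negbK CT.
    by exists x; rewrite // b0 sub0set.
  exists x; first by case/bdryP: xb.
  apply/subsetP => z zb; rewrite inE; apply/eqP.
  exact: (card_le1_eqP le1).
apply: (one_link bC xC) => u v uC vC uv.
by apply/set1P/(subsetP lx)/bdryP; split=> //; exists u.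
Qed.

(** * Bad components outside a closed neighbourhood *)

Definition bcomp v H : bool := is_comp (~: nbh [set v]) H && bad H.

Lemma bcompT v H : bcomp v H -> H != setT.
Proof.
case/andP=> /is_compP[/subsetP HN _ _ _] _; apply/eqP => HT.
have := HN v; rewrite HT in_setC => /(_ (in_setT v)).
by rewrite nbh1 eqxx.
Qed.

Lemma bcomp_nbh v H x : bcomp v H -> x \in H -> x \notin nbh [set v].
Proof. by case/andP=> /is_compP[/subsetP HN _ _ _] _ /HN; rewrite in_setC. Qed.

Lemma bcomp_bdry v H : bcomp v H -> bdry H \subset nb v.
Proof.
move=> bH; have /andP[/bdry_comp/subsetP sub _] := bH.
apply/subsetP => x xb; have := sub x xb; rewrite nbh1 in_nb => /predU1P[xv|//].
have /bdryP[_ [y yH yx]] := xb; have := bcomp_nbh bH yH.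
by rewrite nbh1 e_sym -xv yx orbT.
Qed.

Lemma bcomp_exit v H u w : bcomp v H -> u \in H -> e u w -> w \notin H -> w \in nb v.
Proof.
move=> bH uH uw wH; apply: (subsetP (bcomp_bdry bH)); apply/bdryP; split=> //.
by exists u.
Qed.

Lemma bcomp_gt1 v H : bcomp v H -> 2 <= #|bdry H|.
Proof. by move=> bH; apply: bad_bdry (bcompT bH); case/andP: bH. Qed.

(** [tool] for the vertex v with N[v] discarded, a set of deg v + 1 vertices. *)
Lemma nbad_lower v : #|nb v| < nbad (~: nbh [set v]) + 4.
Proof.
have N0 : nbh [set v] != set0 by apply/set0Pn; exists v; rewrite nbh1 eqxx.
have val : valid [set v] (nbh [set v]) by move=> a b c d _ + _ _ _.
have := tool N0 val; rewrite (card_nbh1 e_irr) cards1.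
by move: (ncomp _ _) (ncomp _ _); clear => *; lia.
Qed.

Lemma bdry_disjoint v x H H' : bcomp v H -> bcomp v H' -> x \in bdry H -> x \in bdry H' ->
  H = H'.
Proof.
move=> bH bH' xH xH'; apply/eqP; apply: contraT => neqH.
have xv := subsetP (bcomp_bdry bH) x xH.
have N0 : nbh [set v] != set0 by apply/set0Pn; exists v; rewrite nbh1 eqxx.
(* Choosing all of N[v] touches every bad component, by connectedness. With m of them, (deg v + 1) +
   5m < 5(deg v + 1) + m. *)
have many : nbad (~: nbh [set v]) <= #|nb v|.
  have val : valid (nbh [set v]) (nbh [set v]).
    by move=> a b c d _ + _ _ _; apply: contra; apply: (subsetP (sub_nbh _ _)).
  have := tool N0 val; rewrite (@ncomp_eq _ _ (touched (nbh [set v])) bad) => [|B cB].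
    by rewrite (card_nbh1 e_irr); move: (ncomp _ _) #|_|; clear => *; lia.
  rewrite /touched; have [|u [w [uB wv uw]]] := comp_exit cB (y := v).
    by rewrite nbh1 eqxx.
  suff -> : ~~ [disjoint B & nbh (nbh [set v])] by rewrite andbT.
  by apply/pred0Pn; exists u; rewrite /= uB (nbh_edge wv) // e_sym.
have val : valid [set v; x] (nbh [set v]).
  by move=> a b c d _ + _ _ _; apply: contra; rewrite nbhU in_setU => ->.
(* {v, x} touches two bad components, which forces more of them than N[v] allows. *)
have := tool N0 val.
have le2 : 2 <= ncomp (touched [set v; x]) (~: nbh [set v]).
  have <- : #|[set H; H']| = 2 by rewrite cards2 neqH.
  apply: subset_leq_card; apply/subsetP => B.
  have tch : forall B, bcomp v B -> x \in bdry B ->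
      is_comp (~: nbh [set v]) B && touched [set v; x] B.
    move=> B' /andP[-> bB] /bdryP[_ [y yB yx]]; rewrite /touched bB /=.
    by apply/pred0Pn; exists y; rewrite /= yB (nbh_edge (u := x)) ?set22 // e_sym.
  by rewrite in_set2 => /orP[]/eqP->; rewrite inE; apply: tch.
have : #|[set v; x]| <= 2 by rewrite cards2; case: (_ != _).
rewrite (card_nbh1 e_irr); move: le2 many.
by move: (ncomp _ _) (ncomp _ _) #|nb v| #|[set v; x]|; clear => *; lia.
Qed.

(** Double counting: a neighbour of v borders at most one bad component. *)
Lemma sum_bdry v : \sum_(H | bcomp v H) #|bdry H| <= #|nb v|.
Proof.
have -> : \sum_(H | bcomp v H) #|bdry H| =
    \sum_(H | bcomp v H) \sum_(x in nb v) (x \in bdry H).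
  apply: eq_bigr => H bH; rewrite -big_mkcondr /= sum1_card; apply: eq_card => x.
  by rewrite [RHS]inE; apply/idP/andP => [xH|[]//]; rewrite (subsetP (bcomp_bdry bH)).
rewrite exchange_big /= -sum1_card; apply: leq_sum => x xv.
rewrite -big_mkcondr /= sum1_card; apply/card_le1P => H /andP[bH xH] H'.
apply/idP/idP => [/andP[bH' xH']|/eqP->]; last exact/andP.
exact/eqP/(bdry_disjoint bH' bH xH' xH).
Qed.

Lemma nbadE v : nbad (~: nbh [set v]) = #|[set H | bcomp v H]|.
Proof. by []. Qed.

(** * The bad set on the side of [v] *)

Lemma comp_edge Z K u w : is_comp Z K -> u \in K -> w \in Z -> e u w -> w \in K.
Proof. by case/is_compP => _ _ _ cl; apply: cl. Qed.

Lemma side_bad H x y : bad H -> H != setT -> x \notin H -> y \in H -> e y x ->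
  (forall z, z \in H -> z \notin nbh [set y] -> #|nb z :\: (x |: H)| <= 1) ->
  0 < nbad (~: (x |: H)).
Proof.
move=> badH HT xH yH yx left1.
have [W cW coverW] := bad_cover e_sym e_irr badH (small_bad badH HT) yH.
have xH0 : x |: H != set0 by apply/set0Pn; exists x; rewrite setU11.
have val : valid (y |: W) (x |: H).
  move=> a b c d sq aD bD cD dD; apply/negP; rewrite in_setU1 => /predU1P[ax|aH].
    by move: aD; rewrite ax (nbh_edge (u := y)) ?setU11.
  have /andP[/and5P[ab _ ad _ /andP[bd _]] /and4P[eab _ _ eda]] := sq.
  have out z : z \notin nbh (y |: W) -> z != a -> z \notin x |: H.
    move=> zD za; rewrite in_setU1 negb_or; apply/andP; split.
      by apply: contraNneq zD => ->; rewrite (nbh_edge (u := y)) ?setU11.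
    by apply/negP => zH; case/eqP: za; apply: coverW.
  have ay : a \notin nbh [set y] by move: aD; rewrite nbhU in_setU negb_or => /andP[].
  have /card_le1_eqP/(_ b d) := left1 a aH ay.
  rewrite !inE eab e_sym eda -!in_setU1 !out // 1?eq_sym // => /(_ isT isT) E.
  by rewrite E eqxx in bd.
have cY : #|x |: H| = 5 * #|W| + 5 by rewrite cardsU1 xH -cW; lia.
have lt := tool xH0 val; rewrite cY in lt.
by move: lt (leq_card_setU [set y] W).1; rewrite cards1; move: #|_ |: W| (ncomp _ _) (ncomp _ _); clear => *; lia.
Qed.

(** A bad component without v would have x as its only outside neighbour: one meeting N(v) outside x
    contains v, and all edges leaving H end in N(v). [one_link] excludes that. *)
Lemma bad_side v H x y : bcomp v H -> x \in nb v -> y \in H -> e y x ->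
  (forall z, z \in H -> z \notin nbh [set y] -> #|nb z :\: (x |: H)| <= 1) ->
  exists K, [/\ is_comp (~: (x |: H)) K, bad K, v \in K & nb v :\ x \subset K].
Proof.
move=> bH xv yH yx left1; have /andP[cH badH] := bH.
have xH : x \notin H.
  by move: (xv); rewrite in_nb => vx; apply/negP => /(bcomp_nbh bH); rewrite nbh1 vx orbT.
have := side_bad badH (bcompT bH) xH yH yx left1.
case/ncomp_gt0 => K [cK bK]; have /is_compP[/subsetP KY _ kK clK] := cK.
have xK : x \notin K by apply/negP => /KY; rewrite in_setC setU11.
have HK z : z \in K -> z \notin H by move/KY; rewrite in_setC in_setU1 negb_or => /andP[].
have vH : v \notin H by apply/negP => /(bcomp_nbh bH); rewrite nbh1 eqxx.
have vx : v != x by apply: contraTneq xv => <-; rewrite in_nb e_irr.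
have vK : v \in K.
  apply: contraT => vK; case: (one_link bK xK) => u w uK wK uw.
  apply/eqP; apply: contraT => wx; case/negP: wK; apply: (clK u w) => //.
  rewrite in_setC in_setU1 (negbTE wx) /=; apply/negP => wH.
  have wu : e w u by rewrite e_sym.
  have := bcomp_exit bH wH wu (HK u uK); rewrite in_nb e_sym => uv.
  by case/negP: vK; apply: (clK u v); rewrite // in_setC in_setU1 negb_or vx.
exists K; split=> //; apply/subsetP => z; rewrite in_setD1 in_nb => /andP[zx vz].
apply: (clK v z) => //; rewrite in_setC in_setU1 negb_or zx /=; apply/negP => /(bcomp_nbh bH).
by rewrite nbh1 vz orbT.
Qed.

Lemma card_outside A v : v \in A -> #|A :\: nbh [set v]| = #|A| - (degin A v).+1.
Proof.
move=> vA; rewrite -(cardsID (nbh [set v]) A).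
suff -> : #|A :&: nbh [set v]| = (degin A v).+1 by rewrite addKn.
by rewrite nbh1E setIUr (setIidPr _) ?sub1set // cardsU1 in_setI in_nb e_irr andbF setIC.
Qed.

Lemma degin_side v x K : x \in nb v -> x \notin K -> nb v :\ x \subset K ->
  degin K v = #|nb v|.-1.
Proof.
move=> xv xK sub; rewrite (cardsD1 x (nb v)) xv /=.
congr #|pred_of_set _|; apply/setP => z; rewrite in_setI in_setD1.
have [->|zx] := eqVneq z x; first by rewrite (negbTE xK) andbF.
case: (boolP (z \in nb v)) => //= zv.
by apply: (subsetP sub); rewrite in_setD1 zx.
Qed.

Lemma side_notin H x K : is_comp (~: (x |: H)) K -> x \notin K.
Proof. by case/is_compP => /subsetP KY _ _ _; apply/negP => /KY; rewrite in_setC setU11. Qed.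

Lemma side_disjoint H x K z : is_comp (~: (x |: H)) K -> z \in K -> z \notin H.
Proof.
by case/is_compP => /subsetP KY _ _ _ /KY; rewrite in_setC in_setU1 negb_or => /andP[].
Qed.

Lemma bcomp_eq v H H' z : bcomp v H -> bcomp v H' -> z \in H -> z \in H' -> H = H'.
Proof. by case/andP=> cH _ /andP[cH' _]; apply: comp_eq cH'. Qed.

(** As boundaries are disjoint, H2 is attached to a neighbour of v other than x, and K contains all
    of those. *)
Lemma other_in_side v H H2 x K : bcomp v H -> bcomp v H2 -> H2 != H -> x \in bdry H ->
  is_comp (~: (x |: H)) K -> nb v :\ x \subset K -> H2 \subset K.
Proof.
move=> bH bH2 neq xH cK sub; have := bcomp_gt1 bH2.
have xv := subsetP (bcomp_bdry bH) x xH; rewrite in_nb in xv.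
case: (set_0Vmem (bdry H2)) => [->|[x2 x2b] _]; first by rewrite cards0.
have x2v := subsetP (bcomp_bdry bH2) x2 x2b.
have x2x : x2 != x.
  by apply: contraNneq neq => x2x; rewrite x2x in x2b; rewrite (bdry_disjoint bH2 bH x2b xH).
have x2K : x2 \in K by apply: (subsetP sub); rewrite in_setD1 x2x.
have /bdryP[_ [y yH2 yx2]] := x2b.
have H2Y : H2 \subset ~: (x |: H).
  apply/subsetP => z zH2; rewrite in_setC in_setU1 negb_or; apply/andP; split.
    apply: contraTneq zH2 => ->; apply/negP => /(bcomp_nbh bH2).
    by rewrite nbh1 xv orbT.
  by apply: contra neq => zH; rewrite (bcomp_eq bH2 bH zH2 zH).
have yK : y \in K by apply: (comp_edge cK x2K); rewrite ?(subsetP H2Y) // e_sym.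
by apply: (comp_max e_sym cK _ H2Y yH2 yK); case/andP: bH2 => /is_compP[].
Qed.

(** Outside x + H, a vertex of H can only be adjacent to x', which gives the hypothesis of
    [bad_side] for free. *)
Lemma bad_side2 v H x x' : bcomp v H -> bdry H = [set x; x'] ->
  exists K, [/\ is_comp (~: (x |: H)) K, bad K, v \in K & nb v :\ x \subset K].
Proof.
move=> bH Hxx'; have xb : x \in bdry H by rewrite Hxx' set21.
have xv := subsetP (bcomp_bdry bH) x xb; have /bdryP[xH [y yH yx]] := xb.
apply: (bad_side bH xv yH yx) => z zH _; rewrite -[X in _ <= X](cards1 x').
apply: subset_leq_card; apply/subsetP => w; rewrite in_setD in_setU1 negb_or in_nb.
case/andP=> /andP[wx wH] zw; have : w \in bdry H by apply/bdryP; split=> //; exists z.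
by rewrite Hxx' !inE (negbTE wx).
Qed.

(** * Vertices of degree at least five *)

Lemma twin_side v H H2 x x' : 4 < #|nb v| -> bcomp v H -> bcomp v H2 -> H2 != H ->
  bdry H = [set x; x'] -> x != x' ->
  exists K, [/\ is_comp (~: (x |: H)) K, bad K, #|K| = 9,
    (forall u, u \in K -> e v u -> u \in nbh [set x']) /\ nb v :\ x \subset K &
    exists u t, [/\ u \in K, e v u, u != x' & degin K u = 4] /\
                [/\ t \in K, e v t, t != u & ~~ e u t]].
Proof.
move=> k5 bH bH2 neq Hxx' nxx'; have [K [cK bK vK sub]] := bad_side2 bH Hxx'.
have xb : x \in bdry H by rewrite Hxx' set21.
have x'b : x' \in bdry H by rewrite Hxx' set22.
have xv := subsetP (bcomp_bdry bH) x xb; have x'v := subsetP (bcomp_bdry bH) x' x'b.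
have xK := side_notin cK.
have KT : K != setT by apply: contraNneq xK => ->; rewrite inE.
have degv := degin_side xv xK sub.
have sK := small_bad bK KT; have [le4 le3] := bad_maxdeg e_irr bK sK vK.
(* At least four neighbours of v lie in K, too many for a set of four vertices. *)
have c9 : #|K| = 9.
  by case: sK => // /le3; rewrite degv; case: #|nb v| k5 => [|[|[|[|[|]]]]].
have d4 : degin K v = 4.
  by move: le4; rewrite degv; case: #|nb v| k5 => [|[|[|[|[|[|]]]]]].
have H2K := other_in_side bH bH2 neq xb cK sub.
(* Exactly 9 - 5 = 4 vertices of K lie outside N[v], and H2 has at least four. *)
have H2E : H2 = K :\: nbh [set v].
  apply/eqP; rewrite eqEcard; apply/andP; split.
    by apply/subsetP => z zH2; rewrite in_setD (bcomp_nbh bH2 zH2) (subsetP H2K).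
  have /andP[_ badH2] := bH2; rewrite card_outside // c9 d4.
  by case: (small_bad badH2 (bcompT bH2)) => ->.
have x'K : x' \in K by apply: (subsetP sub); rewrite in_setD1 x'v eq_sym nxx'.
have [||tw [u [t [[uK vu ux' du] [tK vt tu ut]]]]] := bad9_twin e_sym e_irr bK c9 vK d4 x'K.
- by rewrite -in_nb.
(* A neighbour of x' in K outside N[v] would lie in H2, and x' would border both components. *)
- move=> u uK x'u; apply: contraT => uv; case/negP: neq.
  have uH2 : u \in H2 by rewrite H2E in_setD uv.
  apply/eqP; apply: (bdry_disjoint bH2 bH (x := x')) => //.
  apply/bdryP; split; last by exists u; rewrite // e_sym.
  by rewrite in_nb in x'v; apply/negP => /(bcomp_nbh bH2); rewrite nbh1 x'v orbT.
by exists K; split=> //; exists u, t.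
Qed.

Lemma deg_le4 v : #|nb v| <= 4.
Proof.
rewrite leqNgt; apply/negP => k5; have low := nbad_lower v; have sum := sum_bdry v.
rewrite nbadE in low.
(* Boundaries of size at least 3 would give 3(deg v - 3) <= deg v, which fails from degree 5 on. *)
have [H bH le2] : exists2 H, bcomp v H & #|bdry H| <= 2.
  apply/exists_inP; apply: contraT; rewrite negb_exists_in => /forall_inP ge3.
  have : \sum_(H | bcomp v H) 3 <= \sum_(H | bcomp v H) #|bdry H|.
    by apply: leq_sum => H /ge3; rewrite -ltnNge.
  rewrite sum_nat_const -[#|_|]/#|bcomp v| -cardsE.
  by move: low sum k5; move: (\sum_(H | _) _) #|_| #|_|; clear => *; lia.
have [x [x' [nxx' Hxx']]] : exists x x', x != x' /\ bdry H = [set x; x'].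
  by apply/cards2P; rewrite eqn_leq le2 (bcomp_gt1 bH).
have [H2 bH2 neq] : exists2 H2, bcomp v H2 & H2 != H.
  have /card_gt0P[H2] : 0 < #|[set H0 | bcomp v H0] :\ H|.
    have := cardsD1 H [set H0 | bcomp v H0]; rewrite inE bH.
    by move: low k5; move: #|_| #|_| #|_|; clear => *; lia.
  by rewrite in_setD1 inE => /andP[? ?]; exists H2.
have [K [cK bK c9 [tw sub] [u [t [[uK vu ux' du] [tK vt tu ut]]]]]] :=
  twin_side k5 bH bH2 neq Hxx' nxx'.
have Hx'x : bdry H = [set x'; x] by rewrite setUC.
have [K' [_ _ _ [tw' sub'] _]] : exists K', [/\ is_comp (~: (x' |: H)) K', bad K', #|K'| = 9,
    (forall u, u \in K' -> e v u -> u \in nbh [set x]) /\ nb v :\ x' \subset K' & True].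
  have [|K' [? ? ? ? _]] := twin_side k5 bH bH2 neq Hx'x; first by rewrite eq_sym.
  by exists K'.
have xK := side_notin cK.
have ux : u != x by apply: contraTneq uK => ->.
(* Exchanging x and x' gives a second side K', where x is the twin of v; u lies in K' as well. *)
have xu : e x u.
  have uK' : u \in K' by apply: (subsetP sub'); rewrite in_setD1 ux' in_nb.
  by have := tw' u uK' vu; rewrite nbh1 (negbTE ux).
have x'u : e x' u by have := tw u uK vu; rewrite nbh1 (negbTE ux').
have x't : e x' t.
  have := tw t tK vt; rewrite nbh1; case/predU1P => // tx'.
  by case/negP: ut; rewrite tx' e_sym.
have xN : x \in nbh [set u] by rewrite nbh1 e_sym xu orbT.
have x'N : x' \in nbh [set u] by rewrite nbh1 e_sym x'u orbT.
have HN a w : a \in H -> e a w -> w \notin H -> w \in nbh [set u].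
  move=> aH aw wH; have : w \in bdry H by apply/bdryP; split=> //; exists a.
  by rewrite Hxx' in_set2 => /orP[]/eqP->.
have /andP[/is_compP[_ H0 kH _] badH] := bH.
have uH := side_disjoint cK uK.
(* The boundary {x, x'} of H lies in N[u], so H is a bad component for u too. K - N[u] will be
   another one, also bordered by x'. *)
have cHu : bcomp u H.
  rewrite /bcomp badH andbT; apply/is_compP; split=> //.
    apply/subsetP => z zH; rewrite in_setC nbh1 negb_or; apply/andP; split.
      by apply: contraTneq zH => ->.
    apply: contraT; rewrite negbK => uz.
    have : u \in bdry H by apply/bdryP; split=> //; exists z; rewrite // e_sym.
    by rewrite Hxx' !inE (negbTE ux) (negbTE ux').
  move=> a w aH; rewrite in_setC => wN aw; apply: contraNT wN; exact: HN aw.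
pose Q := K :\: nbh [set u].
have badQ : bad Q.
  by apply: (bad4I e_sym); rewrite ?card_outside ?c9 ?du //; apply: bad9_C4.
have tQ : t \in Q by rewrite in_setD tK nbh1 negb_or tu ut.
have cQu : bcomp u Q.
  rewrite /bcomp badQ andbT; have [kQ _] := badP badQ; apply/is_compP; split=> //.
  - by apply/subsetP => z; rewrite in_setD in_setC => /andP[].
  - by apply/set0Pn; exists t.
  move=> a w; rewrite in_setD => /andP[aN aK]; rewrite in_setC in_setD => wN aw.
  rewrite wN /=; apply: (comp_edge cK aK) => //; rewrite in_setC in_setU1 negb_or.
  apply/andP; split; first by apply: contraNneq wN => ->.
  apply/negP => wH; case/negP: aN; apply: (HN w) => //; first by rewrite e_sym.
  exact: side_disjoint cK aK.
have tH := side_disjoint cK tK.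
suff HQ : H = Q by rewrite HQ tQ in tH.
apply: (bdry_disjoint cHu cQu (x := x')); first by rewrite Hxx' set22.
apply/bdryP; split; first by rewrite in_setD x'N.
by exists t; rewrite // e_sym.
Qed.

(** * Vertices of degree four *)

Lemma two_comps v H H2 : #|nb v| = 4 -> bcomp v H -> bcomp v H2 -> H2 = H.
Proof.
move=> k4 bH bH2; apply/eqP; apply: contraT => neq.
have sum := sum_bdry v; rewrite k4 (bigD1 H) //= (bigD1 H2) /= in sum; last by rewrite bH2.
(* Both boundaries have at least two elements, and together they have at most four. *)
have le2 : #|bdry H| == 2.
  by move: (bcomp_gt1 bH) (bcomp_gt1 bH2) sum; move: #|_| #|_| (\sum_(_ | _) _); clear => *; lia.
have {le2} /cards2P[x [x' [nxx' Hxx']]] := le2.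
have [K [cK bK vK sub]] := bad_side2 bH Hxx'.
have xb : x \in bdry H by rewrite Hxx' set21.
have x'b : x' \in bdry H by rewrite Hxx' set22.
have xv := subsetP (bcomp_bdry bH) x xb; have x'v := subsetP (bcomp_bdry bH) x' x'b.
have xK := side_notin cK.
have KT : K != setT by apply: contraNneq xK => ->; rewrite inE.
have degv : degin K v = 3 by rewrite (degin_side xv xK sub) k4.
have H2K := other_in_side bH bH2 neq xb cK sub.
have /andP[_ badH2] := bH2; have sH2 := small_bad badH2 (bcompT bH2).
have leH2 : #|H2| <= #|K| - 4.
  rewrite -[4]/(3.+1) -degv -card_outside //; apply: subset_leq_card.
  by apply/subsetP => z zH2; rewrite in_setD (bcomp_nbh bH2 zH2) (subsetP H2K).
have c9 : #|K| = 9.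
  by case: (small_bad bK KT) leH2 => -> //; case: sH2 => ->.
have c4 : #|H2| = 4 by move: leH2; rewrite c9; case: sH2 => ->.
have x'K : x' \in K by apply: (subsetP sub); rewrite in_setD1 x'v eq_sym nxx'.
rewrite in_nb in x'v.
have /C4P[a [b [c [d [aH bH' cH dH sq]]]]] := bad_C4 badH2.
have out z : z \in H2 -> e x' z -> H2 = H.
  move=> zH2 x'z; apply: (bdry_disjoint bH2 bH _ x'b); apply/bdryP; split.
    by apply/negP => /(bcomp_nbh bH2); rewrite nbh1 x'v orbT.
  by exists z; rewrite // e_sym.
(* x' is adjacent to the C4 of H2, so it borders H2 as well as H. *)
have := bad9_attach e_sym e_irr bK c9 vK degv x'K x'v sq.
rewrite !(subsetP H2K) // !(bcomp_nbh bH2) // => /(_ isT isT isT isT isT isT isT isT).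
by case/or4P => /out E; case/eqP: neq; apply: E.
Qed.

Lemma degin_out A z : #|nb z| = degin A z + #|nb z :\: A|.
Proof. by rewrite cardsID. Qed.

Lemma bad4_antipode H y z z' : bad H -> #|H| = 4 -> y \in H -> z \in H -> z' \in H ->
  z \notin nbh [set y] -> z' \notin nbh [set y] -> z = z'.
Proof.
move=> bH c4 yH zH z'H zy z'y.
have [W cW] := bad_cover e_sym e_irr bH (or_introl c4) yH.
have /eqP : #|W| = 0 by move: cW; rewrite c4; case: #|W| => // n; rewrite mulnS; lia.
by rewrite cards_eq0 => /eqP->; rewrite setU0; apply.
Qed.

Lemma bad4_deg H y : bad H -> #|H| = 4 -> y \in H -> 2 <= degin H y.
Proof.
move=> bH c4 yH; have [p [z [q [sq HE]]]] := bad4P bH c4 yH.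
have /andP[/and5P[_ _ _ _ /andP[pq _]] /and4P[yp _ _ qy]] := sq.
rewrite e_sym in qy; rewrite HE /degin -[2]/(1 + 1)%N.
have -> : 1 + 1 = #|[set p; q]| by rewrite cards2 pq.
by apply: subset_leq_card; apply/subsetP => w; rewrite !inE => /orP[]/eqP->; rewrite ?yp ?qy !eqxx ?orbT.
Qed.

(* Discarding N[y] leaves the C4 formed by v, z and the two outer neighbours of z, which
   must then be a whole component. *)
Lemma antipode_closed v H y z : #|nb v| = 4 -> bcomp v H -> #|H| = 4 ->
  y \in H -> z \in H -> z \notin nbh [set y] ->
  #|nb y :\: H| = 2 -> #|nb z :\: H| = 2 -> [disjoint nb y :\: H & nb z :\: H] ->
  nb v = (nb y :\: H) :|: (nb z :\: H) ->
  forall u w, u \in nb z :\: H -> e u w -> w \in nbh [set v] :|: H.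
Proof.
move=> k4 bH c4 yH zH zy oy oz disj nbv u w uz uw.
have /andP[_ badH] := bH.
have vH : v \notin H by apply/negP => /(bcomp_nbh bH); rewrite nbh1 eqxx.
have zNy h : h \in H -> h != z -> h \in nbh [set y].
  move=> hH hz; apply: contraT => hy; case/eqP: hz.
  exact: (bad4_antipode badH c4 yH hH zH hy zy).
have vy : v \notin nbh [set y].
  rewrite nbh1 negb_or (contraNneq _ vH) => [|->//].
  by have := bcomp_nbh bH yH; rewrite nbh1 negb_or e_sym => /andP[].
have outy u' : u' \in nb z :\: H -> u' \notin nbh [set y].
  move=> u'z; have := u'z; rewrite in_setD => /andP[u'H _].
  rewrite nbh1 negb_or (contraNneq _ u'H) => [|->//]; rewrite /= -in_nb.
  apply/negP => u'y; have /pred0P/(_ u') := disj.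
  by rewrite /= u'z in_setD u'H u'y.
have nbvz u' : u' \in nb z :\: H -> e v u' by rewrite -in_nb nbv in_setU => ->; rewrite orbT.
have nbvy u' : u' \in nb y :\: H -> e v u' by rewrite -in_nb nbv in_setU => ->.
have Ny w' : w' \in nbh [set y] -> w' \in H \/ w' \in nb y :\: H.
  rewrite nbh1 in_setD in_nb => /predU1P[->|->]; first by left.
  by case: (w' \in H); [left|right].
have degy : #|nb y| = 4.
  by apply/eqP; rewrite eqn_leq deg_le4 (degin_out H) oy (leq_add2r 2 2) bad4_deg.
have := nbad_lower y; rewrite degy -[4 in X in X -> _]add0n ltn_add2r => /ncomp_gt0[C [cC badC]].
have bC : bcomp y C by rewrite /bcomp cC.
have uC : v \in C -> forall u', u' \in nb z :\: H -> u' \in C.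
  by move=> vC u' u'z; apply: (comp_edge cC vC); rewrite ?in_setC ?outy ?nbvz.
(* If C contains v, it is the expected C4. If not, C turns out to be a bad component outside N[v]
   that differs from H, against [two_comps]. *)
have [vC|vC] := boolP (v \in C).
  have zC : z \in C.
    apply: (comp_edge cC (uC vC u uz)); first by rewrite in_setC.
    by move: uz; rewrite in_setD in_nb e_sym => /andP[].
  have dv : degin C v <= 2.
    rewrite -oz; apply: subset_leq_card; apply/subsetP => w'.
    rewrite in_setI nbv in_setU => /andP[/orP[|//]]; rewrite in_setD => /andP[_].
    by rewrite in_nb => yw' /(bcomp_nbh bC); rewrite nbh1 yw' orbT.
  (* In order 9 every vertex of C would have degree at least 3 in C. *)
  have cC4 : #|C| = 4.
    case: (small_bad badC (bcompT bC)) => // c9.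
    by have := bad9_mindeg e_sym e_irr badC c9 vC; rewrite leqNgt ltnS dv.
  have CE : C = [set v; z] :|: (nb z :\: H).
    apply/esym/eqP; rewrite eqEcard !subUset !sub1set vC zC /= cC4.
    apply/andP; split; first by apply/subsetP; apply: uC.
    rewrite cardsU oz cards2 (contraNneq _ vH) => [|->//].
    rewrite (_ : _ :&: _ = set0) ?cards0 //; apply/setP => w'.
    rewrite !inE; case: (altP eqP) => [->|_] /=.
      by apply/negP => /andP[_ zv]; move: (bcomp_nbh bH zH); rewrite nbh1 e_sym zv orbT.
    by case: (altP eqP) => [->|_]; rewrite ?zH.
  have [wy|wy] := boolP (w \in nbh [set y]).
    rewrite in_setU nbh1; case: (Ny w wy) => [->|/nbvy->]; by rewrite ?orbT.
  have : w \in C by apply: (comp_edge cC (uC vC u uz)); rewrite ?in_setC.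
  rewrite CE !in_setU !in_set1 -orbA nbh1 => /or3P[->//|/eqP->|/nbvz->]; by rewrite ?zH ?orbT.
have zuC u' : u' \in nb z :\: H -> u' \notin C.
  move=> u'z; apply: contra vC => u'C; apply: (comp_edge cC u'C); rewrite ?in_setC //.
  by rewrite e_sym nbvz.
have HC h : h \in C -> h \notin H.
  move=> hC; apply/negP => hH; have [hz|hz] := eqVneq h z.
    case/negP: (zuC u uz); rewrite hz in hC; apply: (comp_edge cC hC); first by rewrite in_setC outy.
    by move: uz; rewrite in_setD in_nb => /andP[].
  by case/negP: (bcomp_nbh bC hC); apply: zNy.
have bvC : bcomp v C.
  rewrite /bcomp badC andbT; have /is_compP[_ C0 kC _] := cC; apply/is_compP; split=> //.
    apply/subsetP => c cC'; rewrite in_setC nbh1 negb_or (contraNneq _ vC) => [|<-//].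
    rewrite /= -in_nb nbv in_setU negb_or; apply/andP; split.
      apply/negP; rewrite in_setD in_nb => /andP[_ yc].
      by case/negP: (bcomp_nbh bC cC'); rewrite nbh1 yc orbT.
    by apply: contraL cC' => /zuC.
  move=> a b aC; rewrite in_setC => bv ab.
  have [by'|by'] := boolP (b \in nbh [set y]); last by apply: (comp_edge cC aC); rewrite ?in_setC.
  case: (Ny b by') => [bH'|/nbvy vb]; last by rewrite nbh1 vb orbT in bv.
  have : a \in nb v by apply: (bcomp_exit bH bH'); rewrite 1?e_sym // HC.
  rewrite nbv in_setU => /orP[|/zuC/negP//]; rewrite in_setD in_nb => /andP[_ ya].
  by case/negP: (bcomp_nbh bC aC); rewrite nbh1 ya orbT.
have [c cC'] := bad_n0 badC; have := HC c cC'.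
by rewrite -(two_comps k4 bH bvC) cC'.
Qed.

(** If [bad_side] does not apply at y0, then H has order 4 and the vertex z opposite to y0 has two
    neighbours outside H. The same attempt at z gives two for y0. If every attempt fails, these four
    vertices form N(v), and [antipode_closed] at both ends makes the graph N[v] + H, of order 9. *)
Lemma side_exists v H : #|nb v| = 4 -> bcomp v H -> exists x y K,
  [/\ x \in nb v, y \in H, e y x, v \in K & nb v :\ x \subset K] /\
  is_comp (~: (x |: H)) K /\ bad K.
Proof.
move=> k4 bH; have /andP[_ badH] := bH; have sH := small_bad badH (bcompT bH).
have [x0 x0b] : exists x0, x0 \in bdry H.
  by apply/set0Pn; rewrite -card_gt0; apply: leq_trans (bcomp_gt1 bH).
have /bdryP[x0H [y0 y0H yx0]] := x0b; have x0v := subsetP (bcomp_bdry bH) x0 x0b.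
pose good x y := [forall z in H, (z \notin nbh [set y]) ==> (#|nb z :\: (x |: H)| <= 1)].
have conclude x y : y \in H -> x \notin H -> e y x -> good x y -> exists x y K,
  [/\ x \in nb v, y \in H, e y x, v \in K & nb v :\ x \subset K] /\
  is_comp (~: (x |: H)) K /\ bad K.
  move=> yH xH yx /forall_inP g; have xv := bcomp_exit bH yH yx xH.
  have [|K [? ? ? ?]] := bad_side bH xv yH yx; last by exists x, y, K.
  by move=> z /g/implyP.
case: sH => c; last first.
  (* In order 9 the degree inside H is at least 3, so each vertex has at most one neighbour
     outside. *)
  apply: (conclude x0 y0) => //; apply/forall_inP => z zH; apply/implyP => _.
  have := deg_le4 z; rewrite (degin_out H); have := bad9_mindeg e_sym e_irr badH c zH.
  have : #|nb z :\: (x0 |: H)| <= #|nb z :\: H|.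
    by apply: subset_leq_card; apply: setDS; apply: subsetUr.
  by move: #|_| #|_| (degin _ _); clear => *; lia.
have fail x y : y \in H -> ~~ good x y ->
    exists z, [/\ z \in H, z \notin nbh [set y], #|nb z :\: H| = 2 & x \notin nb z :\: H].
  move=> yH; rewrite negb_forall_in => /exists_inP[z zH]; rewrite negb_imply -ltnNge.
  case/andP=> zy; rewrite setUC -setDDl => gt1; exists z.
  have le2 : #|nb z :\: H| <= 2.
    have := deg_le4 z; rewrite (degin_out H); have := bad4_deg badH c zH.
    by move: #|_| (degin _ _); clear => *; lia.
  have := cardsD1 x (nb z :\: H); case: (boolP (x \in nb z :\: H)) => xz E.
    by move: le2; rewrite E leqNgt ltnS gt1.
  by split=> //; apply/eqP; rewrite eqn_leq le2 E.
have [g|/fail-/(_ y0H)[z [zH zy oz x0z]]] := boolP (good x0 y0); first exact: conclude g.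
have yz : y0 \notin nbh [set z].
  by move: zy; rewrite !nbh1 eq_sym e_sym.
have outz x : x \in nb z :\: H -> e z x /\ x \notin H.
  by rewrite in_setD in_nb => /andP[].
have step x : x \in nb z :\: H -> (exists x y K,
  [/\ x \in nb v, y \in H, e y x, v \in K & nb v :\ x \subset K] /\
  is_comp (~: (x |: H)) K /\ bad K) \/ #|nb y0 :\: H| = 2 /\ x \notin nb y0 :\: H.
  move=> /outz[zx xH]; have [g|/fail-/(_ zH)[y [yH yz' oy xy]]] := boolP (good x z).
    by left; apply: conclude zH xH zx g.
  by right; rewrite -(bad4_antipode badH c zH yH y0H yz' yz).
have [x1 x1z] : exists x1, x1 \in nb z :\: H by apply/set0Pn; rewrite -card_gt0 oz.
have [//|[oy _]] := step x1 x1z.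
have [d|] := boolP [disjoint nb y0 :\: H & nb z :\: H]; last first.
  by case/pred0Pn => x /andP[/= xy /step[//|[_]]]; rewrite xy.
have nbv : nb v = (nb y0 :\: H) :|: (nb z :\: H).
  apply/esym/eqP; rewrite eqEcard subUset k4 cardsU oy oz.
  rewrite (disjoint_setI0 d) cards0 andbT; apply/andP; split.
    apply/subsetP => x; rewrite in_setD in_nb => /andP[xH yx].
    exact: bcomp_exit bH y0H yx xH.
  by apply/subsetP => x /outz[zx xH]; apply: bcomp_exit bH zH zx xH.
case: T_big; right; rewrite cardsT.
have d' : [disjoint nb z :\: H & nb y0 :\: H] by rewrite disjoint_sym.
have nbv' : nb v = (nb z :\: H) :|: (nb y0 :\: H) by rewrite setUC.
have clz := antipode_closed k4 bH c y0H zH zy oy oz d nbv.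
have cly := antipode_closed k4 bH c zH y0H yz oz oy d' nbv'.
have vU : v \in nbh [set v] :|: H by rewrite in_setU nbh1 eqxx.
have UT : setT \subset nbh [set v] :|: H.
  apply: (connP e_sym (in_setT v) T_conn) => // u w _ _.
  rewrite nbh1E => /setUP[/setU1P[->|uv]|uH] uw.
  - by rewrite !in_setU in_nb uw orbT.
  - rewrite nbv in uv.
    by rewrite -nbh1E; case/setUP: uv => [uy|uz]; [apply: cly uy uw | apply: clz uz uw].
  have [wH|wH] := boolP (w \in H); first by rewrite in_setU wH orbT.
  by have := bcomp_exit bH uH uw wH; rewrite !in_setU => ->; rewrite orbT.
rewrite -cardsT; have /eqP-> : setT == nbh [set v] :|: H by rewrite eqEsubset UT subsetT.
rewrite cardsU (card_nbh1 e_irr) k4 c (disjoint_setI0 _) ?cards0 //.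
by rewrite disjoint_sym; apply/pred0P => z1 /=; apply/negP => /andP[/(bcomp_nbh bH)/negP].
Qed.

(** A cycle crosses a cut an even number of times, so it cannot use a single crossing edge. *)
Lemma C4_cross A B :
  (forall x y x' y', x \in A -> y \in B -> x' \in A -> y' \in B ->
     e x y -> e x' y' -> x = x' /\ y = y') ->
  ~~ C4_in A -> ~~ C4_in B -> ~~ C4_in (A :|: B).
Proof.
move=> uniq_cross nA nB; apply/negP => /C4P[a [b [c [d [aU bU cU dU sq]]]]].
have out z : z \in A :|: B -> z \notin A -> z \in B by case/setUP => [->|].
have next p q r s : is_C4 p q r s -> p \in A :|: B -> q \in A :|: B -> r \in A :|: B ->
    s \in A :|: B -> p \in A -> q \in A.
  case/andP=> /and5P[_ pr ps _ /andP[qs _]] /and4P[pq qr rs sp] pU qU rU sU pA.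
  apply: contraT => qA; have qB := out q qU qA.
  have [rA|rA] := boolP (r \in A).
    by case: (uniq_cross p q r q) => // [|E]; [rewrite e_sym | rewrite E eqxx in pr].
  have rB := out r rU rA; have [sA|sA] := boolP (s \in A).
    by case: (uniq_cross p q s r) => // [|E]; [rewrite e_sym | rewrite E eqxx in ps].
  by case: (uniq_cross p q p s) => // [||_ E]; [exact: out | rewrite e_sym | rewrite E eqxx in qs].
have sq2 := sq; rewrite C4_rot in sq2; have sq3 := sq2; rewrite C4_rot in sq3.
have sq4 := sq3; rewrite C4_rot in sq4.
have ab := next _ _ _ _ sq aU bU cU dU; have bc := next _ _ _ _ sq2 bU cU dU aU.
have cd := next _ _ _ _ sq3 cU dU aU bU; have da := next _ _ _ _ sq4 dU aU bU cU.
have [aA|aA] := boolP (a \in A).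
  by case/negP: nA; apply/C4P; exists a, b, c, d; split=> //; auto.
have dA := contra da aA; have cA := contra cd dA; have bA := contra bc cA.
by case/negP: nB; apply/C4P; exists a, b, c, d; split=> //; apply: out.
Qed.

(** At most |W| + 2 vertices x, w, W deal with x + B + O, which has 5|W| + 14 vertices; without a
    bad component in the rest this contradicts [tool]. The remainders of B and O are joined by at
    most one edge: a vertex of B with an outside neighbour has degree at most 3 in B, [remove9]
    leaves at most one such vertex, and it has only one outside neighbour. *)
Lemma nine_side B O x b0 o0 : bad B -> bad O -> B != setT -> O != setT -> #|B| = 9 ->
  b0 \in B -> e x b0 -> x \notin B -> o0 \in O -> e x o0 -> x \notin O -> [disjoint B & O] ->
  (forall u w, u \in B :|: O -> e u w -> w \notin B :|: O -> w = x) ->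
  (forall C, is_comp (~: (x |: (B :|: O))) C -> ~~ bad C) -> False.
Proof.
move=> bB bO BT OT c9 b0B xb0 xB o0O xo0 xO dis cl noC.
have [w [wB iw am]] := bad9_remove e_sym e_irr bB c9 b0B.
have [W iW cW] := bad_touched e_sym e_irr bO (small_bad bO OT) o0O.
have low u y : u \in B -> e u y -> y \notin B -> degin B u <= 3 /\ #|nb u :\: B| <= 1.
  move=> uB uy yB; have := deg_le4 u; rewrite (degin_out B).
  have := bad9_mindeg e_sym e_irr bB c9 uB.
  have : 0 < #|nb u :\: B| by apply/card_gt0P; exists y; rewrite in_setD yB in_nb.
  by move: #|_| (degin _ _); clear => *; split; lia.
have {}am := am (low b0 x b0B (etrans (e_sym _ _) xb0) xB).1.
pose D0 := x |: (w |: W).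
have xD0 : x \in D0 by rewrite setU11.
have Y0 : x |: (B :|: O) != set0 by apply/set0Pn; exists x; rewrite setU11.
have val : valid D0 (x |: (B :|: O)).
  move=> a b c d sq aD bD cD dD; have /andP[_ /and4P[ab bc cd da]] := sq.
  have neqx z : z \notin nbh D0 -> z != x.
    by apply: contraNneq => ->; apply: (subsetP (sub_nbh _ _)).
  rewrite in_setU1 (negbTE (neqx a aD)) /=; apply/negP => aU.
  have step u z : u \in B :|: O -> e u z -> z \notin nbh D0 -> z \in B :|: O.
    by move=> uU uz zD; apply: contraT => zU; case/eqP: (neqx z zD); apply: cl uz zU.
  have bU := step a b aU ab bD; have cU := step b c bU bc cD; have dU := step c d cU cd dD.
  have inU z : z \in B :|: O -> z \notin nbh D0 ->
      z \in (B :\ b0 :\: nbh [set w]) :|: (O :\ o0 :\: nbh W).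
    move=> zU zD; have zb : z != b0 by apply: contraNneq zD => ->; apply: nbh_edge xb0.
    have zo : z != o0 by apply: contraNneq zD => ->; apply: nbh_edge xo0.
    move: zD; rewrite /D0 !nbhU !in_setU !negb_or => /and3P[_ zw zW].
    by rewrite !in_setD !in_set1 zb zo zw zW -in_setU.
  have /negP[] : ~~ C4_in ((B :\ b0 :\: nbh [set w]) :|: (O :\ o0 :\: nbh W)).
    apply: C4_cross iw iW => p q p' q'.
    rewrite !in_setD !in_set1 => /and3P[pw pb pB] /and3P[_ _ qO] /and3P[p'w p'b p'B] /and3P[_ _ q'O] pq pq'.
    have notB z : z \in O -> z \notin B by move=> zO; rewrite (disjointFl dis zO).
    have [p3 p1] := low p q pB pq (notB q qO).
    have [p'3 _] := low p' q' p'B pq' (notB q' q'O).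
    have E : p = p' by apply: am.
    split=> //; apply: (card_le1_eqP p1); last by rewrite in_setD notB // in_nb.
    by rewrite in_setD notB // in_nb E.
  by apply/C4P; exists a, b, c, d; split; rewrite ?inU.
have := tool Y0 val; rewrite cardsU1 in_setU negb_or xB xO /= cardsU (disjoint_setI0 dis) cards0 c9.
rewrite [ncomp bad _]ncomp_eq0 // /D0 !cardsU1 -cW.
by move: (_ \notin _) (_ \notin _) (ncomp _ _) #|W|; clear => -[] [] *; lia.
Qed.

(** x is the only exit from J, and a C4 visits it at most once. *)
Lemma C4_block J x a b c d : (forall u w, u \in J -> e u w -> w \in x |: J) ->
  is_C4 a b c d -> a \in J -> [/\ b \in x |: J, c \in x |: J & d \in x |: J].
Proof.
move=> cl sq aJ; have /andP[/and5P[_ _ _ _ /andP[bd _]] /and4P[ab bc cd da]] := sq.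
have bJ := cl a b aJ ab; have dJ : d \in x |: J by apply: (cl a); rewrite // e_sym.
split=> //; case/setU1P: bJ => [bx|bJ]; last exact: cl bJ bc.
case/setU1P: dJ => [dx|dJ]; first by rewrite bx dx eqxx in bd.
by apply: (cl d); rewrite // e_sym.
Qed.

(** x separates H and K from the rest J. [nine_side] excludes a part of order 9, so x + H + K has
    nine vertices, and this set and x + J are compared as two blocks sharing x. *)
Lemma no_deg4 v : #|nb v| = 4 -> False.
Proof.
move=> k4; have := nbad_lower v; rewrite k4 -[4 in X in X -> _]add0n ltn_add2r => /ncomp_gt0[H [cH badH]].
have bH : bcomp v H by rewrite /bcomp cH.
have [x [y [K [[xv yH yx vK sub] [cK bK]]]]] := side_exists k4 bH.
have HT := bcompT bH; have sH := small_bad badH HT.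
have vx : e v x by rewrite -in_nb.
have xH : x \notin H by apply/negP => /(bcomp_nbh bH); rewrite nbh1 vx orbT.
have xK := side_notin cK.
have KT : K != setT by apply: contraNneq xK => ->; rewrite inE.
have sK := small_bad bK KT; have HKd z : z \in K -> z \notin H := side_disjoint cK.
have dis : [disjoint H & K].
  by apply/pred0P => z /=; apply/negP => /andP[zH /HKd]; rewrite zH.
have degv : degin K v = 3 by rewrite (degin_side xv xK sub) k4.
have clHK u w : u \in H :|: K -> e u w -> w \notin H :|: K -> w = x.
  rewrite !in_setU negb_or => /orP[uH|uK] uw /andP[wH wK]; apply/eqP; apply: contraT => wx.
    case/negP: wK; apply: (subsetP sub); rewrite in_setD1 wx.
    exact: bcomp_exit bH uH uw wH.
  by case/negP: wK; apply: (comp_edge cK uK _ uw); rewrite in_setC in_setU1 negb_or wx.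
pose J := ~: (x |: (H :|: K)).
have xJ : x \notin J by rewrite in_setC setU11.
have clJ u w : u \in J -> e u w -> w \in x |: J.
  move=> uJ uw; rewrite in_setU1 in_setC in_setU1 negb_or; case: eqP => //= wx.
  apply/negP => wHK; have : u = x.
    apply: clHK wHK _ _; first by rewrite e_sym.
    by move: uJ; rewrite in_setC in_setU1 negb_or => /andP[].
  by move=> ux; rewrite -ux uJ in xJ.
have noJ C : is_comp J C -> ~~ bad C.
  move=> cC; have /is_compP[/subsetP CJ _ _ cl] := cC; apply/negP => bC.
  apply: (one_link bC (x := x)); first by apply: contra xJ; apply: CJ.
  move=> u w uC wC uw; case/setU1P: (clJ u w (CJ u uC) uw) => // wJ.
  by case/negP: wC; apply: cl uw.
have xy : e x y by rewrite e_sym.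
have xv' : e x v by rewrite e_sym.
case: (sH) => cH4; last exact: (nine_side badH bK HT KT cH4 yH xy xH vK xv' xK dis clHK noJ).
case: (sK) => cK4; last first.
  rewrite disjoint_sym in dis.
  by apply: (nine_side bK badH KT HT cK4 vK xv' xK yH xy xH dis); rewrite [K :|: H]setUC.
pose B9 := x |: (H :|: K).
have cB9 : #|B9| = 9.
  by rewrite cardsU1 in_setU negb_or xH xK /= cardsU (disjoint_setI0 dis) cards0 cH4 cK4.
have cT : #|T| = 9 + #|J| by rewrite -cB9 cardsC.
have [z zJ] : exists z, z \in J.
  apply/set0Pn; apply: contra_notN T_big => /eqP J0; right.
  by rewrite cardsT cT J0 cards0.
have cJx : #|x |: J| = #|J|.+1 by rewrite cardsU1 xJ.
have outJ u : u \notin J -> u \in B9 by rewrite in_setC negbK.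
have kJx : conn (x |: J).
  apply/(connP e_sym (setU11 x J)) => S xS cl; rewrite subUset sub1set xS /=.
  apply/subsetP => s sJ; apply: contraT => sS.
  have [||u [w [uR wR uw]]] := @exit_edge (J :\: S) s x.
  - by rewrite in_setD sS.
  - by rewrite in_setD (negbTE xJ) andbF.
  move: uR; rewrite in_setD => /andP[uS uJ]; case/negP: uS.
  have wJ := clJ u w uJ uw; apply: (cl w u) => //; last by rewrite e_sym.
    by rewrite in_setU1 uJ orbT.
  case/setU1P: wJ wR => [->//|wJ]; by rewrite in_setD wJ andbT negbK.
have kB9 : conn B9.
  have /andP[kH _] := badH; have /andP[kK _] := bK.
  rewrite /B9 setUA; apply: (conn_edge e_sym (x := x) (y := v)) => //.
    by rewrite setU11.
  by apply: (conn_edge e_sym (x := x) (y := y)); rewrite ?set11 ?conn1.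
have zxJ : z != x by apply: contraNneq xJ => <-.
have isolT D : isol (x |: J) D -> (forall a b c d, is_C4 a b c d ->
    a \notin J -> b \notin J -> c \notin J -> d \notin J -> a \notin nbh D ->
    b \notin nbh D -> c \notin nbh D -> d \notin nbh D -> False) -> isol setT D.
  move=> iD out; apply: isol_intro => a b c d sq _ _ _ _ aD bD cD dD.
  have anyJ p q r s : is_C4 p q r s -> p \notin nbh D -> q \notin nbh D -> r \notin nbh D ->
      s \notin nbh D -> p \notin J.
    move=> sq' pD qD rD sD; apply/negP => pJ; have [qJ rJ sJ] := C4_block clJ sq' pJ.
    case/negP: iD; apply/C4P; exists p, q, r, s.
    by split=> //; rewrite in_setD ?pD ?qD ?rD ?sD // in_setU1 pJ orbT.
  have sq2 := sq; rewrite C4_rot in sq2; have sq3 := sq2; rewrite C4_rot in sq3.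
  have sq4 := sq3; rewrite C4_rot in sq4.
  apply: (out a b c d) => //; [exact: anyJ sq _ _ _ _|exact: anyJ sq2 _ _ _ _|
    exact: anyJ sq3 _ _ _ _|exact: anyJ sq4 _ _ _ _].
have [badJ|nbJ] := boolP (bad (x |: J)).
  have JT : x |: J != setT.
    apply/eqP => JT; have := in_setT y; rewrite -JT in_setU1 in_setC in_setU1 in_setU yH orbT orbF.
    by move/eqP => yx'; rewrite yx' (negbTE xH) in yH.
  have [W iW cW] := bad_touched e_sym e_irr badJ (small_bad badJ JT) (setU11 x J).
  (* v dominates K, x dominates y and leaves three vertices of H. Here |T| = 5|W| + 12, against a
     cost of at most 5(|W| + 2). *)
  have /T_no : isol setT (x |: (v |: W)).
    have neqx p : p \notin nbh (x |: (v |: W)) -> p != x.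
      by apply: contraNneq => ->; apply: (subsetP (sub_nbh _ _)); apply: setU11.
    apply: isolT => [|a b c d sq aJ bJ cJ dJ aD bD cD dD].
      apply: isol_intro => a b c d sq aJ bJ cJ dJ aD bD cD dD.
      case/negP: iW; apply/C4P; exists a, b, c, d.
      rewrite !in_setD !in_set1 !neqx // aJ bJ cJ dJ.
      by move: aD bD cD dD; rewrite !nbhU !in_setU !negb_or; do 4![case/and3P=> _ _ ->].
    have inHy p : p \notin J -> p \notin nbh (x |: (v |: W)) -> p \in H :\ y.
      move=> /outJ; rewrite in_setU1 in_setU in_setD1 => pB pD; move: (pD) pB.
      rewrite (negbTE (neqx p pD)) /= !nbhU !in_setU !negb_or => /and3P[px pv _].
      rewrite (contraNneq _ px) => [|->] /=; last by rewrite nbh1 xy orbT.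
      case/orP => // pK; have : K :\: nbh [set v] != set0.
        by apply/set0Pn; exists p; rewrite in_setD pv.
      by rewrite -card_gt0 card_outside // cK4 degv.
    have := C4_card sq (inHy a aJ aD) (inHy b bJ bD) (inHy c cJ cD) (inHy d dJ dD).
    by have := cardsD1 y H; rewrite yH cH4 add1n => -[<-].
  move: cW (leq_card_setU [set x] (v |: W)).1 (leq_card_setU [set v] W).1.
  rewrite cT cJx !cards1; move: #|_| #|_| #|_| #|_|; clear => *; lia.
have [D1 iD1 le1] := nbad_isol kJx nbJ; rewrite cJx in le1.
have [badB|nbB] := boolP (bad B9); last first.
  (* D2 has at most one vertex, and 5|D1| + 5 <= |J| + 6 is below the order |J| + 9. *)
  have [D2 iD2 le2] := nbad_isol kB9 nbB; rewrite cB9 in le2.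
  have /T_no : isol setT (D1 :|: D2).
    apply: isolT => [|a b c d sq aJ bJ cJ dJ aD bD cD dD].
      exact: isol_mono (subxx _) (subsetUl _ _) iD1.
    case/negP: iD2; apply/C4P; exists a, b, c, d; rewrite !in_setD !outJ //.
    by move: aD bD cD dD; rewrite !nbhU !in_setU !negb_or; do 4![case/andP=> _ ->].
  move: le1 le2 (leq_card_setU D1 D2).1.
  rewrite cT; move: #|_| #|_| #|_| #|_|; clear => *; lia.
have xB9 : x \in B9 by rewrite setU11.
have dx3 : degin B9 x <= 3.
  have [u [w [uJ wJ uw]]] := exit_edge zJ xJ.
  have wx : w = x by case/setU1P: (clJ u w uJ uw) => // wJ'; rewrite wJ' in wJ.
  have := deg_le4 x; rewrite (degin_out B9).
  have : 0 < #|nb x :\: B9|.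
    apply/card_gt0P; exists u; rewrite in_setD in_nb -wx e_sym uw andbT.
    by move: uJ; rewrite in_setC.
  by move: #|_| (degin _ _); clear => *; lia.
(* All neighbours of v' lie in B9 and x is not one of them. So T - N[v'] is connected through x, and
   as v' has degree 4 it must be bad; it has more than four vertices, yet t has degree at most 2 in
   it. *)
have [v' [t [[v'B dv' v'x v'nx] [tB tx tv' dt]]]] := bad9_far e_sym e_irr badB cB9 xB9 dx3.
have nbv' : nb v' \subset B9.
  have : #|nb v' :\: B9| = 0.
    by have := deg_le4 v'; rewrite (degin_out B9) dv'; case: #|_|.
  by move/eqP; rewrite cards_eq0 setD_eq0.
pose Q := B9 :\: nbh [set v'].
have cQ : #|Q| = 4 by rewrite card_outside // cB9 dv'.
have badQ : bad Q by apply: (bad4I e_sym cQ); apply: bad9_C4.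
have xQ : x \in Q by rewrite in_setD xB9 nbh1 negb_or eq_sym v'x v'nx.
have kZ : conn (Q :|: (x |: J)).
  by apply: (connU e_sym xQ (setU11 x J)) => //; case/andP: badQ.
have ZE : ~: nbh [set v'] = Q :|: (x |: J).
  apply/setP => w; rewrite in_setC in_setU in_setD in_setU1.
  have [wJ|/outJ wB] := boolP (w \in J); last first.
    rewrite wB andbT; case: (altP eqP) => [->|_]; last by rewrite /= orbF.
    by rewrite nbh1 negb_or eq_sym v'x v'nx.
  rewrite !orbT; move: wJ; rewrite in_setC => wJ; apply: contra wJ.
  by rewrite nbh1E => /setU1P[->//|]; apply: (subsetP nbv').
have v'4 : #|nb v'| = 4 by rewrite -dv' /degin (setIidPl nbv').
have := nbad_lower v'; rewrite v'4 -[4 in X in X -> _]add0n ltn_add2r => /ncomp_gt0[C [cC badC]].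
have [c cC'] := bad_n0 badC.
have ZC : Q :|: (x |: J) \subset C.
  apply: (comp_max e_sym cC kZ _ (x := c)) => //; first by rewrite ZE.
  by have /is_compP[CZ _ _ _] := cC; rewrite -ZE (subsetP CZ).
have bC : bcomp v' C by rewrite /bcomp cC.
have tQ : t \in Q by rewrite in_setD tv'.
have tC : t \in C by apply: (subsetP ZC); rewrite in_setU tQ.
have zQ : z \notin Q.
  by rewrite in_setD negb_and; apply/orP; right; move: zJ; rewrite in_setC.
have gt4 : 4 < #|C|.
  rewrite -cQ; apply: proper_card; apply/properP; split.
    exact: subset_trans (subsetUl _ _) ZC.
  by exists z => //; apply: (subsetP ZC); rewrite !in_setU zJ !orbT.
case: (small_bad badC (bcompT bC)) => cC9; first by rewrite cC9 in gt4.
have := bad9_mindeg e_sym e_irr badC cC9 tC; rewrite leqNgt ltnS => /negP[].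
apply: leq_trans dt; apply: subset_leq_card; apply/subsetP => w.
rewrite !in_setI => /andP[tw wC]; rewrite tw /=; have /is_compP[/subsetP CZ _ _ _] := cC.
have := CZ w wC; rewrite ZE => /setUP[//|/setU1P[->//|wJ]].
have tHK : t \in H :|: K by move: tB; rewrite in_setU1 (negbTE tx).
have wHK : w \notin H :|: K by move: wJ; rewrite in_setC in_setU1 negb_or => /andP[].
rewrite in_nb in tw; by rewrite -(clHK t w tHK tw wHK) wJ in xJ.
Qed.

(** * Maximum degree three *)

Lemma deg_le3 v : #|nb v| <= 3.
Proof.
have := deg_le4 v; rewrite leq_eqVlt => /predU1P[/no_deg4//|].
by rewrite ltnS.
Qed.

Lemma bad_card4 A : bad A -> A != setT -> #|A| = 4.
Proof.
move=> bA AT; case: (small_bad bA AT) => // c9.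
have [y yA dy] := bad9_deg4 e_sym e_irr bA c9.
by have := deg_le3 y; rewrite (degin_out A) dy.
Qed.

(** Y is a C4 with an outside neighbour a' of a. The vertex a is valid for Y: only c escapes N[a],
    and c has at most one neighbour besides b and d. As |Y| = 5, a bad H of order 4 exists. Removing
    H with a boundary vertex y0 makes the rest of Y a bad component, and the graph is Y + H, of
    order 9. *)
Lemma minimal_False : False.
Proof.
have [a [b [c [d [a' [sq aa' a'U]]]]]] : exists a b c d a',
    [/\ is_C4 a b c d, e a a' & a' \notin [set a; b; c; d]].
  have /C4P[a [b [c [d [_ _ _ _ sq]]]]] := bad_C4 T_bad.
  have c4 : #|[set a; b; c; d]| = 4.
    have /card_uniqP := C4_uniq sq; rewrite /= => <-.
    by apply: eq_card => x; rewrite !inE -!orbA.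
  have badU : bad [set a; b; c; d].
    apply: (bad4I e_sym c4); apply/C4P; exists a, b, c, d.
    by rewrite !inE !eqxx ?orbT.
  have [y yU] : exists y, y \notin [set a; b; c; d].
    have /subsetPn[y _ yU] : ~~ (setT \subset [set a; b; c; d]); last by exists y.
    apply: contra_notN T_big => sub; left; apply/eqP; rewrite eqn_leq -{1}c4 subset_leq_card //.
    by rewrite -c4 subset_leq_card ?subsetT.
  have aU : a \in [set a; b; c; d] by rewrite !inE eqxx.
  have [u [w [uU wU uw]]] := exit_edge aU yU.
  (* The edge may leave the C4 at any vertex, so the cycle is rewritten to start there. *)
  have [p [z [q [sq' E]]]] := bad4P badU c4 uU.
  by exists u, p, z, q, w; rewrite -E.
have /andP[/and5P[ab ac ad bc /andP[bd cd]] /and4P[eab ebc ecd eda]] := sq.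
have [a'a a'b a'c a'd] : [/\ a' != a, a' != b, a' != c & a' != d].
  by move: a'U; rewrite !inE !negb_or -!andbA => /and4P.
have in3 v x y z w : e v x -> e v y -> e v z -> x != y -> x != z -> y != z -> e v w ->
    [|| w == x, w == y | w == z].
  move=> vx vy vz xy xz yz vw; apply: contraT; rewrite !negb_or => /and3P[wx wy wz].
  have := deg_le3 v; rewrite leqNgt => /negP[].
  have u4 : uniq [:: w; x; y; z] by rewrite /= !inE !negb_or wx wy wz xy xz yz.
  rewrite -[4](card_uniqP u4) subset_leq_card // subset_all.
  by rewrite /= !in_nb vw vx vy vz.
have sym x y : e x y -> e y x by rewrite e_sym.
have nba w : e a w -> [|| w == b, w == d | w == a'].
  by apply: in3; rewrite ?(eq_sym _ a') //; apply: sym.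
pose Y := [set a; b; c; d; a'].
have inY w : (w \in Y) = [|| w == a, w == b, w == c, w == d | w == a'].
  by rewrite !inE -!orbA.
have cY : #|Y| = 5.
  have u5 : uniq [:: a; b; c; d; a'].
    by rewrite /= !inE !negb_or ab ac ad bc bd cd !(eq_sym _ a') a'a a'b a'c a'd.
  by rewrite -[5](card_uniqP u5); apply: eq_card => w; rewrite inY !inE.
have Y0 : Y != set0 by rewrite -card_gt0 cY.
have val : valid [set a] Y.
  move=> p q r s sq' pN qN rN sN; rewrite inY.
  have notN z w : z \notin nbh [set a] -> (w == a) || e a w -> z != w.
    by move=> zN aw; apply: contraNneq zN => ->; rewrite nbh1.
  have ead : e a d by rewrite e_sym.
  rewrite (negbTE (notN p a pN _)) ?eqxx // (negbTE (notN p b pN _)) ?eab ?orbT //.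
  rewrite (negbTE (notN p d pN _)) ?ead ?orbT // (negbTE (notN p a' pN _)) ?aa' ?orbT //.
  rewrite /= orbF; apply/negP => /eqP pc; rewrite {p pN}pc in sq'.
  have /andP[/and5P[_ _ _ _ /andP[qs _]] /and4P[ecq _ _ esc]] := sq'.
  have qb : q != b by apply: notN qN _; rewrite eab orbT.
  have qd : q != d by apply: notN qN _; rewrite ead orbT.
  have sb : s != b by apply: notN sN _; rewrite eab orbT.
  have sd : s != d by apply: notN sN _; rewrite ead orbT.
  have : [|| s == b, s == d | s == q].
    by apply: (in3 c); rewrite // 1?eq_sym //; apply: sym.
  by rewrite (negbTE sb) (negbTE sd) [s == q]eq_sym (negbTE qs).
have /ncomp_gt0[H [cH badH]] : 0 < nbad (~: Y).
  have := tool Y0 val; rewrite cY cards1; move: (ncomp _ _) (ncomp _ _); clear => *; lia.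
have /is_compP[/subsetP HY H0 kH clH] := cH.
have YH w : w \in Y -> w \notin H by move=> wY; apply/negP => /HY; rewrite in_setC wY.
have HT : H != setT.
  by apply/eqP => HT; have := YH a; rewrite HT inY eqxx inE => /(_ isT).
have cH4 := bad_card4 badH HT.
have bY := subsetP (bdry_comp cH).
(* H has two boundary vertices in Y, so one of them lies on the C4. It is not a, whose neighbours
   are all in Y. *)
have [y0 y0b y0a'] : exists2 y0, y0 \in bdry H & y0 != a'.
  have /card_gt0P[y0] : 0 < #|bdry H :\ a'|.
    have := cardsD1 a' (bdry H); have := bad_bdry badH HT.
    by move: #|_| #|_| (_ \in _) => m n []; clear => *; lia.
  by rewrite in_setD1 => /andP[? ?]; exists y0.
have /bdryP[y0H [h hH hy0]] := y0b.
have y0Y := bY y0 y0b.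
have y0a : y0 != a.
  apply: contraTneq hH => y0a; apply: YH; rewrite inY; move: hy0; rewrite y0a e_sym.
  by move/nba/or3P => [] ->; rewrite ?orbT.
have y0bcd : [|| y0 == b, y0 == c | y0 == d].
  by move: y0Y; rewrite inY (negbTE y0a) (negbTE y0a') orbF.
have hU w : w \in Y -> h != w by move=> wY; apply: contraTneq hH => ->; apply: YH.
have nby0 w : e y0 w -> (w \in Y) || (w == h).
  move=> y0w; have y0h : e y0 h by rewrite e_sym.
  have three p q : p \in Y -> q \in Y -> p != q -> e y0 p -> e y0 q -> (w \in Y) || (w == h).
    move=> pY qY pq y0p y0q.
    have := in3 y0 p q h w y0p y0q y0h pq; rewrite ![_ == h]eq_sym !(hU _ _) // => /(_ isT isT y0w).
    by case/or3P=> /eqP->; rewrite ?pY ?qY ?eqxx ?orbT.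
  by case/or3P: y0bcd => /eqP y0E; rewrite y0E in three;
    [apply: (three a c)|apply: (three b d)|apply: (three c a)];
    rewrite ?inY ?eqxx ?orbT // 1?e_sym // eq_sym.
have left1 z : z \in H -> z \notin nbh [set h] -> #|nb z :\: (y0 |: H)| <= 1.
  move=> zH _; have := deg_le3 z; rewrite (degin_out H).
  have := bad4_deg badH cH4 zH.
  have : #|nb z :\: (y0 |: H)| <= #|nb z :\: H|.
    by apply: subset_leq_card; apply: setDS; apply: subsetUr.
  by move: #|_| #|_| (degin _ _); clear => *; lia.
have /ncomp_gt0[C [cC badC]] := side_bad badH HT y0H hH hy0 left1.
have y0C := side_notin cC.
have CT : C != setT by apply: contraNneq y0C => ->; rewrite inE.
have cC4 := bad_card4 badC CT.
pose R := Y :\ y0.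
(* Removing one of b, c, d from the C4 leaves a path through a, and a' is attached to a. *)
have kR : conn R.
  have aR : a \in R by rewrite in_setD1 inY eqxx eq_sym y0a.
  apply/(connP e_sym aR) => S aS cl.
  have inR w : w != y0 -> w \in Y -> w \in R by rewrite in_setD1 => -> ->.
  have a'S : a' \in S by apply: (cl a a') => //; apply: inR; rewrite ?inY ?eqxx ?orbT // eq_sym.
  have step u w : u \in R -> w \in R -> u \in S -> e u w -> w \in S by apply: cl.
  apply/subsetP => w; rewrite in_setD1 inY => /andP[wy0].
  have bS : b != y0 -> b \in S.
    by move=> by0; apply: (cl a b) => //; apply: inR; rewrite ?inY ?eqxx ?orbT.
  have dS : d != y0 -> d \in S.
    by move=> dy0; apply: (cl a d); rewrite ?(sym d a) //; apply: inR; rewrite ?inY ?eqxx ?orbT.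
  case/or4P => [/eqP->//|/eqP wb|/eqP wc|].
  - by rewrite wb; apply: bS; rewrite -wb.
  - rewrite wc; have [by0|by0] := eqVneq b y0.
      have dy0 : d != y0 by rewrite -by0 eq_sym.
      by apply: (cl d c); rewrite ?dS ?(sym c d) // inR ?inY ?eqxx ?orbT // -?wc.
    by apply: (cl b c); rewrite ?bS // inR ?inY ?eqxx ?orbT // -?wc.
  - by case/orP => /eqP wd; rewrite wd //; apply: dS; rewrite -wd.
have RY : R \subset ~: (y0 |: H).
  by apply/subsetP => w; rewrite in_setD1 in_setC in_setU1 negb_or => /andP[-> /YH].
have RC : R = C.
  apply/eqP; rewrite eqEcard cC4; have := cardsD1 y0 Y; rewrite y0Y cY add1n => -[<-].
  rewrite leqnn andbT.
  (* If C missed R, an edge from C to H would start in the boundary of H, hence in Y; so C could be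
     left only through y0. *)
  have [z zC zR] : exists2 z, z \in C & z \in R.
    have [/exists_inP//|no] := boolP [exists z in C, z \in R].
    case: (one_link badC y0C) => u w uC wC uw; apply/eqP; apply: contraT => wy0.
    case/negP: wC; apply: (comp_edge cC uC _ uw); rewrite in_setC in_setU1 negb_or wy0.
    apply/negP => wH; case/negP: no; apply/exists_inP; exists u => //.
    rewrite in_setD1 (contraNneq _ y0C) => [|<-//]; apply: bY; apply/bdryP; split.
      exact: side_disjoint cC uC.
    by exists w; rewrite // e_sym.
  by apply: (comp_max e_sym cC kR RY zR zC).
have TU : setT \subset Y :|: H.
  have aU : a \in Y :|: H by rewrite in_setU inY eqxx.
  apply: (connP e_sym (in_setT a) T_conn) => // u w _ _ uU uw.
  case/setUP: uU => [uY|uH]; last first.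
    have [wH|wH] := boolP (w \in H); first by rewrite in_setU wH orbT.
    by rewrite in_setU bY //; apply/bdryP; split=> //; exists u.
  have [uy0|uy0] := eqVneq u y0.
    rewrite uy0 in uw; have /orP[wY|/eqP->] := nby0 w uw; first by rewrite in_setU wY.
    by rewrite in_setU hH orbT.
  have uC : u \in C by rewrite -RC in_setD1 uy0.
  have [wY|wY] := boolP (w \in y0 |: H).
    by case/setU1P: wY => [->|wH]; rewrite in_setU ?y0Y ?wH ?orbT.
  have : w \in C by apply: (comp_edge cC uC _ uw); rewrite in_setC.
  by rewrite -RC in_setD1 in_setU => /andP[_ ->].
apply: T_big; right; have /eqP-> : setT == Y :|: H by rewrite eqEsubset TU subsetT.
rewrite cardsU cY cH4 (disjoint_setI0 _) ?cards0 //.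
by apply/pred0P => w /=; apply/negP => /andP[/YH/negP].
Qed.

End Minimal.

(** * The bound *)

Section Induced.
Variables (T : finType) (e : rel T) (A : {set T}).
Local Notation sT := {x : T | x \in A}.
Let e' : rel sT := relpre val e.

Lemma card_induced : #|{: sT}| = #|A|.
Proof. by rewrite card_sig; apply: eq_card => x; rewrite inE. Qed.

Lemma induced_isol (D : {set sT}) : isol e' setT D -> isol e A (val @: D).
Proof.
move=> iD; apply: isol_intro => a b c d sq aA bA cA dA aD bD cD dD.
have out (x : T) (xA : x \in A) : x \notin closed_nbhd e (val @: D) ->
    (exist _ x xA : sT) \in setT :\: closed_nbhd e' D.
  rewrite in_setD in_setT andbT; apply: contra => /nbhP[u uD ux].
  by apply/nbhP; exists (val u); rewrite ?imset_f.
case/negP: iD; apply/C4P; exists (exist _ a aA), (exist _ b bA), (exist _ c cA), (exist _ d dA).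
by split; rewrite ?out.
Qed.

Lemma induced_bad : symmetric e -> bad e A -> bad e' setT.
Proof.
move=> e_sym /badP[/forallP cA noD]; apply/andP; split.
  apply/forallP => S; apply/implyP => /and3P[_ /set0Pn[s sS] ST].
  have /implyP/(_ _)/exists_inP[|x] := cA (val @: S).
    apply/and3P; split.
    - by apply/subsetP => _ /imsetP[x _ ->]; apply: (valP x).
    - by apply/set0Pn; exists (val s); apply: imset_f.
    - apply: contraNneq ST => SA; rewrite -subTset; apply/subsetP => x _.
      have : val x \in [set val y | y in S] by rewrite SA; apply: valP.
      by rewrite mem_imset //; apply: val_inj.
  case/imsetP => x' xS -> /exists_inP[y]; rewrite in_setD => /andP[yS yA] xy.
  apply/exists_inP; exists x' => //; apply/exists_inP; exists (exist _ y yA) => //.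
  by rewrite in_setD in_setT andbT; apply: contra yS => yS; apply/imsetP; exists (exist _ y yA).
apply/existsPn => D; apply/negP => /andP[/induced_isol/noD].
by rewrite cardsT card_induced card_imset; [rewrite ltnNge => /negP | apply: val_inj].
Qed.

End Induced.

(** Induction on a bound for the order: a bad proper subset induces a smaller bad graph, so it has
    order 4 or 9, as [minimal_False] requires. *)
Lemma bad_setT_small n (T : finType) (e : rel T) : #|T| <= n -> symmetric e -> irreflexive e ->
  bad e setT -> small (setT : {set T}).
Proof.
elim: n T e => [|n IH] T e leTn e_sym e_irr bT.
  have [x _] := bad_n0 bT; have : 0 < #|T| by apply/card_gt0P; exists x.
  by rewrite ltnNge leTn.
have [/eqP c4|n4] := boolP (#|T| == 4); first by left; rewrite cardsT.
have [/eqP c9|n9] := boolP (#|T| == 9); first by right; rewrite cardsT.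
exfalso; apply: (minimal_False e_sym e_irr bT) => [A bA AT|]; last first.
  by case; rewrite cardsT => /eqP; apply/negP.
have ltA : #|A| < #|T|.
  by rewrite -cardsT proper_card // properT.
have [] := IH {x : T | x \in A} (relpre val e) _ _ _ (induced_bad e_sym bA).
- by rewrite card_induced -ltnS (leq_trans ltA).
- by move=> x y; apply: e_sym.
- by move=> x; apply: e_irr.
- by rewrite cardsT card_induced; left.
- by rewrite cardsT card_induced; right.
Qed.

Lemma iso_of_labelling (T : finType) (e : rel T) m (E : rel 'I_m) (h : 'I_m -> T) :
  injective h -> #|T| = m -> (forall i j, e (h i) (h j) = E i j) -> isomorphic_to e E.
Proof.
move=> hinj cT hE; have [|g gh hg] := inj_card_bij hinj; first by rewrite cT card_ord.
exists g; split; first by exists h.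
by move=> x y; rewrite -hE !hg.
Qed.

Lemma edges_ofE m l (i j : 'I_m) : edges_of l i j = edge_list l i j.
Proof. by []. Qed.

Lemma bad9_in_E4 (T : finType) (e : rel T) : symmetric e -> irreflexive e ->
  bad e setT -> #|T| = 9 -> in_E4 e.
Proof.
move=> e_sym e_irr bT c9; have [|k [h [ltk [hinj _ hk]]]] := bad9_adj e_sym e_irr bT.
  by rewrite cardsT.
have iso (E : rel 'I_9) : (forall i j : 'I_9, E i j = nine_adj k i j) -> isomorphic_to e E.
  by move=> kE; apply: (iso_of_labelling hinj c9) => i j; rewrite hk kE nine_entryE.
case: k ltk {hk} iso => [|[|[|[|[|[|k]]]]]] ltk iso; last by [].
- by do 3![right]; left; apply: iso => i j.
- by do 4![right]; left; apply: iso => i j; apply: edges_ofE.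
- by do 5![right]; left; apply: iso => i j; apply: edges_ofE.
- by do 6![right]; left; apply: iso => i j; apply: edges_ofE.
- by do 7![right]; left; apply: iso => i j; apply: edges_ofE.
- by do 8![right]; apply: iso => i j; apply: edges_ofE.
Qed.

(** The diagonals ac and bd decide between the complete graph, the diamond and the C4; if only bd is
    present, the cycle is rotated first. *)
Lemma bad4_in_E4 (T : finType) (e : rel T) : symmetric e -> irreflexive e ->
  bad e setT -> #|T| = 4 -> in_E4 e.
Proof.
move=> e_sym e_irr bT c4; have /C4P[a [b [c [d [_ _ _ _ sq]]]]] := bad_C4 bT.
have lab p q r s : is_C4 e p q r s -> forall E : rel 'I_4,
    (forall i j : 'I_4, e (nth p [:: p; q; r; s] i) (nth p [:: p; q; r; s] j) = E i j) ->
    isomorphic_to e E.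
  move=> sq' E hE; apply: (@iso_of_labelling _ _ _ _ (fun i : 'I_4 => nth p [:: p; q; r; s] i)) => // i j /eqP.
  by rewrite nth_uniq ?(C4_uniq sq') //; move/eqP/val_inj.
have /andP[_ /and4P[ab bc cd da]] := sq.
have [ac|ac] := boolP (e a c); have [bd|bd] := boolP (e b d).
- right; right; left; apply: lab sq _ _ => i j.
  by case: i => [[|[|[|[|]]]] i] //; case: j => [[|[|[|[|]]]] j] //=; rewrite ?e_irr ?ab ?bc ?cd ?da ?ac ?bd // e_sym ?ab ?bc ?cd ?da ?ac ?bd.
- right; left; apply: lab sq _ _ => i j.
  by case: i => [[|[|[|[|]]]] i] //; case: j => [[|[|[|[|]]]] j] //=; rewrite ?e_irr ?ab ?bc ?cd ?da ?ac ?(negbTE bd) // e_sym ?ab ?bc ?cd ?da ?ac ?(negbTE bd).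
- right; left; rewrite C4_rot in sq; apply: lab sq _ _ => i j.
  by case: i => [[|[|[|[|]]]] i] //; case: j => [[|[|[|[|]]]] j] //=; rewrite ?e_irr ?ab ?bc ?cd ?da ?bd ?(negbTE ac) // e_sym ?ab ?bc ?cd ?da ?bd ?(negbTE ac).
- left; apply: lab sq _ _ => i j.
  by case: i => [[|[|[|[|]]]] i] //; case: j => [[|[|[|[|]]]] j] //=; rewrite ?e_irr ?ab ?bc ?cd ?da ?(negbTE bd) ?(negbTE ac) // e_sym ?ab ?bc ?cd ?da ?(negbTE bd) ?(negbTE ac).
Qed.

Lemma isol_isolating (T : finType) (e : rel T) D : isol e setT D = C4_isolating e D.
Proof.
congr (~~ _); apply/C4P/existsP.
  move=> [a [b [c [d [+ + + + sq]]]]]; rewrite !in_setD !in_setT !andbT => aD bD cD dD.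
  exists a; apply/existsP; exists b; apply/existsP; exists c; apply/existsP; exists d.
  by rewrite aD bD cD dD.
case=> a /existsP[b /existsP[c /existsP[d /and3P[/and4P[aD bD cD dD] neq edges]]]].
by exists a, b, c, d; rewrite !in_setD !in_setT !andbT; split=> //; apply/andP.
Qed.

Lemma bigmin_leq (I : eqType) (r : seq I) (P : pred I) (F : I -> nat) z i :
  i \in r -> P i -> \big[minn/z]_(j <- r | P j) F j <= F i.
Proof.
move=> + Pi; elim: r => // j r IH; rewrite inE big_cons => /predU1P[<-|/IH le].
  by rewrite Pi geq_minl.
by case: (P j) => //; rewrite geq_min le orbT.
Qed.

Lemma leq_bigmin (I : eqType) (r : seq I) (P : pred I) (F : I -> nat) z m :
  m <= z -> (forall i, P i -> m <= F i) -> m <= \big[minn/z]_(j <- r | P j) F j.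
Proof. by move=> mz mF; elim/big_rec: _ => // i x /mF mi mx; rewrite leq_min mi. Qed.

Lemma connected_conn (T : finType) (e : rel T) : symmetric e -> connected_graph e -> conn e setT.
Proof.
move=> e_sym cT; case: (set_0Vmem [set: T]) => [E|[x xT]].
  by rewrite E; apply/forallP => S; rewrite subset0; case: eqP.
apply/(connP e_sym xT) => S xS cl; apply/subsetP => y _.
have clS : closed e (mem S).
  by move=> u w uw; apply/idP/idP => [uS|wS]; [apply: (cl u w)|apply: (cl w u)] => //; rewrite e_sym.
by suff: y \in mem S by []; rewrite -(closed_connect clS (cT x y)).
Qed.

Lemma iota_leq (T : finType) (e : rel T) (D : {set T}) :
  C4_isolating e D -> iota_C4 e <= #|D|.
Proof. by move=> iD; apply: bigmin_leq => //; rewrite mem_index_enum. Qed.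

Lemma iota_le_div5 (T : finType) (e : rel T) :
  symmetric e -> irreflexive e -> connected_graph e -> ~ in_E4 e -> iota_C4 e <= #|T| %/ 5.
Proof.
move=> e_sym e_irr cT nE4.
have [bT|nbT] := boolP (bad e setT).
  case: nE4; have [] := bad_setT_small (leqnn _) e_sym e_irr bT; rewrite cardsT.
    exact: bad4_in_E4.
  exact: bad9_in_E4.
have [D iD leD] := nbad_isol (connected_conn e_sym cT) nbT.
rewrite isol_isolating in iD; apply: leq_trans (iota_leq iD) _.
by rewrite leq_divRL // mulnC -cardsT.
Qed.

(** * The extremal graphs *)

Section Extremal.
Variable n : nat.
Local Notation a := (n %/ 5).
Local Notation b := (n - 4 * a).
Local Notation B := (B_C4 n).

Lemma path_isolating : n <= 4 -> C4_isolating B set0.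
Proof.
move=> n4; rewrite -isol_isolating; apply: isol_intro => p q r s.
rewrite /is_C4 /B_C4 /Bdir n4 -!(inj_eq val_inj) /=.
by case/andP => *; lia.
Qed.

(** The centres dominate the whole graph: the vertices from a to b - 1 are joined to a - 1, and each
    copy of C4 to its own centre. *)
Lemma centres_isolating (h : a <= n) : 5 <= n ->
  C4_isolating B (widen_ord h @: setT).
Proof.
move=> n5; rewrite -isol_isolating; apply: isol_intro => v _ _ _ _ _ _ _ _ /negP[].
have dom (u : nat) : u < a -> Bdir n u v -> v \in closed_nbhd B (widen_ord h @: setT).
  move=> ua uv; apply/nbhP; exists (widen_ord h (Ordinal ua)); first exact: imset_f.
  by rewrite /B_C4 /= uv orbT.
have n4 : (n <= 4) = false by lia.
have ltv := ltn_ord v; have [va|va] := ltnP v a.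
  by apply/nbhP; exists (widen_ord h (Ordinal va)); rewrite ?imset_f // -(inj_eq val_inj) eqxx.
have [vb|vb] := ltnP v b.
  by apply: (dom a.-1); rewrite /Bdir ?n4 ?va ?vb ?eqxx ?orbT //; lia.
apply: (dom ((v - b) %/ 4)); first by lia.
rewrite /Bdir n4 vb eqxx; suff -> : (v - b) %/ 4 < a by rewrite !orbT.
by lia.
Qed.

(** Puts a centre i < a together with its copy of C4; the vertices from a to b - 1 get values that
    are no centre. *)
Definition block (v : nat) : nat := if v < b then v else (v - b) %/ 4.

(** A copy of C4 has no neighbour besides its own centre, so it survives if D avoids both. *)
Lemma isolating_meets_block (D : {set 'I_n}) i : C4_isolating B D -> i < a ->
  exists2 d, d \in D & block d = i.
Proof.
move=> iD ia; suff /exists_inP[d dD /eqP bd] : [exists d in D, block d == i] by exists d.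
apply: contraT => noD.
have /exists_inPn {}noD := noD.
have n4 : (n <= 4) = false by lia.
have ltw r : r < 4 -> b + (4 * i + r) < n by lia.
pose w r (lt : r < 4) : 'I_n := Ordinal (ltw r lt).
have wD r (lt : r < 4) : w r lt \notin closed_nbhd B D.
  apply/negP => /nbhP[d dD dw]; case/negP: (noD d dD); apply/eqP.
  have : d = w r lt :> nat \/ Bdir n d (w r lt) \/ Bdir n (w r lt) d.
    by case/orP: dw => [/eqP->|/orP[]]; [left|right; left|right; right].
  rewrite /Bdir n4 /block /=; case: ifP; lia.
case/negP: iD; rewrite -[has_C4_outside _ _]negbK -/(C4_isolating _ _) -isol_isolating negbK.
apply/C4P; exists (w 0 isT), (w 1 isT), (w 2 isT), (w 3 isT).
rewrite !in_setD !in_setT !wD; split=> //.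
have adj r r' (lt : r < 4) (lt' : r' < 4) : r.+1 %% 4 = r' -> B (w r lt) (w r' lt').
  move=> rr'; rewrite /B_C4; apply/orP; left; rewrite /Bdir n4 /= !addKn !leq_addr.
  have q4 s : s < 4 -> (4 * i + s) %/ 4 = i by lia.
  have m4 s : s < 4 -> (4 * i + s) %% 4 = s by lia.
  by rewrite !q4 // !m4 // rr' !eqxx !orbT.
rewrite /is_C4 !adj // andbT -!(inj_eq val_inj) /= !eqn_add2l.
by do ![apply/andP; split].
Qed.

Lemma div5_le_iota : n %/ 5 <= iota_C4 B.
Proof.
(* The default value of the minimum, here n, has to satisfy the bound too. *)
apply: leq_bigmin => [|D iD]; first by rewrite card_ord; lia.
rewrite cardE -(size_map (fun d : 'I_n => block d)) -[a in a <= _](size_iota 0).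
apply: uniq_leq_size (iota_uniq _ _) _ => i; rewrite mem_iota /= add0n => ia.
have [d dD <-] := isolating_meets_block iD ia.
by apply: map_f; rewrite mem_enum.
Qed.

Lemma iota_B_C4 : iota_C4 B = n %/ 5.
Proof.
apply/eqP; rewrite eqn_leq div5_le_iota andbT.
have [n4|n5] := leqP n 4.
  by rewrite (leq_trans (iota_leq (path_isolating n4))) // cards0.
have h : a <= n by lia.
apply: leq_trans (iota_leq (centres_isolating h n5)) _.
by rewrite (leq_trans (leq_imset_card _ _)) // cardsT card_ord.
Qed.

End Extremal.

Theorem theorem2 :
  (forall (T : finType) (e : rel T),
      symmetric e -> irreflexive e -> connected_graph e -> ~ in_E4 e ->
      iota_C4 e <= #|T| %/ 5) /\
  (forall n : nat, iota_C4 (B_C4 n) = n %/ 5).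
Proof. by split; [apply: iota_le_div5 | apply: iota_B_C4]. Qed.
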